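(* Let $n\ge 2$, let $\Omega\subset\mathbb{C}^n$ be a domain with $C^1$ boundary, and let $U\subset\partial\Omega$ be a relatively compact, open region in $\partial\Omega$. Assume that $U$ satisfies the uniform disc property of index $k$ for some $k\in\mathbb{Z}^+$, with associated constant $\delta_0=\delta_0(k,U)>0$. Let $0<\alpha<1/k$ and let $f$ be a holomorphic function on $\Omega$ with $f\in C^\alpha(\Omega)$. Then there exists a constant $C>0$ such that for every normalized complex tangential curve $\gamma:[0,1]\to\Omega$ with $\mathrm{dist}(\gamma(t),\partial\Omega)\le\delta_0/5$ for all $t\in[0,1]$ and $\pi(\gamma([0,1]))\subset U$, and for all $s,t\in[0,1]$, $$|f\circ\gamma(s)-f\circ\gamma(t)|\le C|s-t|^{k\alpha};$$ that is, $C$ is independent of $\gamma$ and of $s,t\in[0,1]$.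
   Context: Tangent vectors are identified with vectors in $\mathbb{C}^n$. For $p\in\partial\Omega$, $N_p$ denotes the unit outward normal vector at $p$, and $(T^{(1,0)}\oplus T^{(0,1)})_p\partial\Omega$ denotes the complex tangential directions at $p$, i.e. the vectors in the maximal complex subspace of the real tangent space $T_p\partial\Omega$. Uniform disc property: let $\Omega\subset\mathbb{C}^n$ ($n\ge2$) be a domain with $C^1$ boundary and $k\in\mathbb{Z}^+$. A set $S\subset\partial\Omega$ satisfies the uniform disc property of index $k$ if there exist $\delta_0=\delta_0(k,S)>0$, $c_1=c_1(k,S)>0$ and $c_2=c_2(k,S)>0$ such that for each $p\in S$, each unit vector $L_p\in T_p^{(1,0)}\oplus T_p^{(0,1)}$ (unit complex tangential vector at $p$), and each $0<\delta\le\delta_0$, $$\left\{Q-w_1N_p+w_2L_p:\ (w_1,w_2)\in W^{1/k}\right\}\subset\Omega,$$ where $Q:=p-\delta N_p$ and $W^{1/k}:=\{(w_1,w_2)\in\mathbb{C}^2:|w_1|\le c_1\delta,\ |w_2|\le c_2\delta^{1/k}\}$. $\pi$ denotes the normal projection from a small neighborhood of $\partial\Omega$ to $\partial\Omega$, so that $\mathrm{dist}(q,\pi(q))=\mathrm{dist}(q,\partial\Omega)$ for $q$ in that neighborhood. Normalized complex tangential curve: a $C^2$-smooth curve $\gamma:[0,1]\to\Omega$ such that $\gamma'(t)\in(T^{(1,0)}\oplus T^{(0,1)})_{\pi(\gamma(t))}\partial\Omega$ and $|\gamma'(t)|=1$ for all $t$. $f\in C^\alpha(\Omega)$ means that there is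 a constant $K$ with $|f(z)-f(w)|\le K|z-w|^\alpha$ for all $z,w\in\Omega$. *)

(* Defs.v *)
From HB Require Import structures.
From mathcomp Require Import all_boot all_order all_algebra.
From mathcomp Require Import complex.
From mathcomp Require Import all_classical all_reals all_analysis.

Set Implicit Arguments.
Unset Strict Implicit.
Unset Printing Implicit Defensive.

Import Order.TTheory GRing.Theory Num.Theory.
Import numFieldNormedType.Exports.

Local Open Scope classical_set_scope.
Local Open Scope complex_scope.
Local Open Scope ring_scope.

(* [R[i]] as a normed module over itself; this is what makes ['rV[R[i]]_n] a
   normed module over [R[i]] and [differentiable] mean complex differentiable. *)
HB.instance Definition _ (R : rcfType) := GRing.ComAlgebra.copy R[i] R[i]^o.
HB.instance Definition _ (R : rcfType) := Vector.copy R[i] R[i]^o.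
HB.instance Definition _ (R : rcfType) := NormedModule.copy R[i] R[i]^o.

Notation cabs := ComplexField.Normc.normc.

Section Euclidean.
Variables (R : realType) (n : nat).
Local Notation Cn := 'rV[R[i]]_n.

(* The real inner product of C^n = R^(2n) and its Euclidean norm. The library
   norm of ['rV[R[i]]_n] is the max norm, hence used only for its topology. *)
Definition rdot (v w : Cn) : R :=
  \sum_(j < n) (complex.Re (v 0 j) * complex.Re (w 0 j) +
                complex.Im (v 0 j) * complex.Im (w 0 j)).

Definition enorm (v : Cn) : R := Num.sqrt (rdot v v).

Definition dist_to (A : set Cn) (q : Cn) : R :=
  inf [set enorm (q - p) | p in A].

Definition bd (A : set Cn) : set Cn := closure A `\` interior A.

Definition domain (Omega : set Cn) : Prop :=
  [/\ Omega !=set0, open Omega & connected Omega].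

End Euclidean.

Section C1Boundary.
Variables (R : realType) (n : nat).
Local Notation Cn := 'rV[R[i]]_n.

Definition along (rho : Cn -> R) (z v : Cn) : R -> R :=
  fun h => rho (z + h%:C *: v).

Definition dirder (rho : Cn -> R) (v z : Cn) : R := derive1 (along rho z v) 0.

Definition ex (j : 'I_n) : Cn := delta_mx 0 j.
Definition ey (j : 'I_n) : Cn := 'i%C *: delta_mx 0 j.

Definition has_continuous_partial (W : set Cn) (rho : Cn -> R) (v : Cn) :=
  forall z, W z -> derivable (along rho z v) 0 1 /\
                   {for z, continuous (dirder rho v)}.

Definition C1_on (W : set Cn) (rho : Cn -> R) : Prop :=
  forall j, has_continuous_partial W rho (ex j) /\
            has_continuous_partial W rho (ey j).

(* R^(2n) gradient, with (d/dx_j, d/dy_j) packed as a complex coordinate. *)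
Definition grad (rho : Cn -> R) (z : Cn) : Cn :=
  \row_j (dirder rho (ex j) z +i* dirder rho (ey j) z).

Definition defining_near (Omega : set Cn) (p : Cn) (W : set Cn)
    (rho : Cn -> R) : Prop :=
  [/\ open W, W p, C1_on W rho,
      Omega `&` W = [set z | rho z < 0] `&` W &
      forall q, bd Omega q -> W q -> grad rho q != 0].

Definition C1_boundary (Omega : set Cn) : Prop :=
  forall p, bd Omega p -> exists W rho, defining_near Omega p W rho.

(* The next two notions do not depend on the chosen local defining function. *)
Definition outward_normal (Omega : set Cn) (p N : Cn) : Prop :=
  exists W rho, defining_near Omega p W rho /\
    N = ((enorm (grad rho p))^-1)%:C *: grad rho p.

Definition real_tangent (Omega : set Cn) (p v : Cn) : Prop :=
  exists W rho, defining_near Omega p W rho /\ rdot v (grad rho p) = 0.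

Definition complex_tangent (Omega : set Cn) (p v : Cn) : Prop :=
  real_tangent Omega p v /\ real_tangent Omega p ('i%C *: v).

Definition uniform_disc_property (Omega S : set Cn) (k : nat) (delta0 : R) :=
  0 < delta0 /\
  exists c1 c2 : R, [/\ 0 < c1, 0 < c2 &
    forall p N L : Cn, S p -> outward_normal Omega p N ->
      complex_tangent Omega p L -> enorm L = 1 ->
    forall delta : R, 0 < delta -> delta <= delta0 ->
    forall w1 w2 : R[i],
      cabs w1 <= c1 * delta -> cabs w2 <= c2 * delta `^ (k%:R^-1) ->
      Omega (p - delta%:C *: N - w1 *: N + w2 *: L)].

(* For a C^1 boundary nearest points need not be unique, so a normal projection
   is any selection of a nearest boundary point on a neighborhood [V]. *)
Definition normal_projection (Omega V : set Cn) (pi_ : Cn -> Cn) : Prop :=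
  [/\ open V, bd Omega `<=` V &
      forall q, V q -> bd Omega (pi_ q) /\
                       enorm (q - pi_ q) = dist_to (bd Omega) q].

End C1Boundary.

Section CurvesAndFunctions.
Variables (R : realType) (n : nat).
Local Notation Cn := 'rV[R[i]]_n.

(* Derivative relative to [0,1], hence one-sided at the endpoints. *)
Definition is_velocity (g : R -> Cn) (t : R) (v : Cn) : Prop :=
  ((s - t)^-1)%:C *: (g s - g t) @[s --> within `[0, 1] t^'] --> v.

Definition C2_curve (g g1 g2 : R -> Cn) : Prop :=
  (forall t : R, t \in `[0, 1] -> is_velocity g t (g1 t) /\
                              is_velocity g1 t (g2 t)) /\
  {within `[0, 1], continuous g2}.

Definition normalized_complex_tangential_curve (Omega V : set Cn)
    (pi_ : Cn -> Cn) (g : R -> Cn) : Prop :=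
  exists g1 g2, C2_curve g g1 g2 /\
    forall t : R, t \in `[0, 1] ->
      [/\ Omega (g t), V (g t), complex_tangent Omega (pi_ (g t)) (g1 t) &
          enorm (g1 t) = 1].

Definition holomorphic_on (Omega : set Cn) (f : Cn -> R[i]) : Prop :=
  forall z, Omega z -> differentiable f z.

Definition holder_on (Omega : set Cn) (alpha : R) (f : Cn -> R[i]) : Prop :=
  exists K : R, forall z w, Omega z -> Omega w ->
    cabs (f z - f w) <= K * enorm (z - w) `^ alpha.

End CurvesAndFunctions.

(* Main.v *)
Require Import Defs.
From HB Require Import structures.
From mathcomp Require Import all_boot all_order all_algebra.
From mathcomp Require Import complex ring lra.
From mathcomp Require Import all_classical all_reals all_analysis.

Import Order.TTheory GRing.Theory Num.Theory.
Import numFieldNormedType.Exports.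

Local Open Scope classical_set_scope.
Local Open Scope complex_scope.
Local Open Scope ring_scope.

Set Implicit Arguments.
Unset Strict Implicit.
Unset Printing Implicit Defensive.

(** The derivative of f in a complex tangential direction blows up more slowly
    at the boundary than the derivative in a general direction, and this is
    where the gain from alpha to k * alpha comes from.

    Let q be at distance x from the boundary, p a nearest boundary point and N
    the unit normal there, so that q = p - x N. The disc property puts a disc
    of radius about x^(1/k) in every complex tangential direction L inside
    Omega. Comparing f on the disc through the point at depth x with f on the
    parallel disc through the point at depth 2x, the Hoelder condition bounds
    the difference by K x^alpha, so Cauchy's estimate bounds the difference of
    the two L-derivatives by C x^(alpha - 1/k). Since alpha < 1/k, summing over
    the depths x, 2x, 4x, ... up to delta0 is a geometric sum dominated by its
    first term: |D_L f| <= A x^(alpha - 1/k) at depth x. This is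
    [tangential_derivative_bound]; the argument tolerates an extra displacement
    of the base point of size kappa * x, which is needed below because the
    boundary is only C^1.

    Let now h = |s - t|. If the curve stays at depth at least h^k between the
    two parameters, integrating the bound gives A h^(k alpha - 1) h. If it comes
    closer than h^k to the boundary at some parameter, it is translated by the
    fixed vector - h^k N0, with N0 the normal at that parameter: the end points
    move by h^k, which costs K h^(k alpha) each, and the translated curve has
    depth at least h^k up to an error h^k |N - N0|. The normal is uniformly
    continuous over the relatively compact set U, so this error is at most
    kappa h^k as soon as h is small, and the derivative bound applies along the
    translated curve. This is [short_curve_estimate]. Long parameter intervals
    are covered by the Hoelder condition alone.

    Three facts carry the rest. Cauchy's estimate [cauchy_estimate] is obtained
    for functions that are merely complex differentiable at each point: by
    Goursat's bisection the integral of a closed form around a rectangle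
    vanishes, and this is applied to (f (exp z) - f 0) exp (- z) on a rectangle
    of height 2 pi. The identification of the normal at a nearest point p with
    (p - q) / |p - q| ([nearest_grad]) holds because the open ball around q of
    radius |p - q| lies in Omega and so any defining function decreases towards
    it. Finally, the chain rule along the curve and the mean value inequality
    ([curve_variation]) only need pointwise differentiability. *)

(** * Bisection and mean value inequalities *)

Lemma nested_intervals (R : realType) (u : nat -> R) (w : R) :
  0 <= w ->
  (forall n, u n <= u n.+1 /\ u n.+1 + w / 2 ^+ n.+1 <= u n + w / 2 ^+ n) ->
  exists x, forall n, u n <= x <= u n + w / 2 ^+ n.
Proof.
move=> w0 step.
have up m n : (m <= n)%N -> u m <= u n.
  by apply: (homo_leq (@lexx _ _) (@le_trans _ _)) => i; have [] := step i.
have dn m n : (m <= n)%N -> u n + w / 2 ^+ n <= u m + w / 2 ^+ m.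
  move=> mn; elim: n mn => [|n IH]; first by rewrite leqn0 => /eqP ->.
  rewrite leq_eqVlt => /predU1P[-> //|]; rewrite ltnS => /IH.
  by apply: le_trans; have [] := step n.
have wn n : 0 <= w / 2 ^+ n by rewrite divr_ge0 // exprn_ge0.
have bnd n : ubound (range u) (u n + w / 2 ^+ n).
  move=> _ [m _ <-]; have [mn|/ltnW nm] := leqP m n.
    by rewrite (le_trans (up _ _ mn)) // lerDl.
  by apply: le_trans (dn _ _ nm); rewrite lerDl.
have ne : range u !=set0 by exists (u 0%N), 0%N.
exists (sup (range u)) => n; apply/andP; split; last exact: ge_sup.
by apply: ub_le_sup; [exists (u 0%N + w / 2 ^+ 0)|exists n].
Qed.

(** The common engine of the local-to-global arguments below: a defect that
    persists under halving both sides of a rectangle concentrates at a point.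
    Intervals are the case h = 0. *)
Lemma bisection (R : realType) (bad : nat -> R -> R -> Prop) (w h : R) x0 y0 :
  0 <= w -> 0 <= h -> bad 0%N x0 y0 ->
  (forall n x y, bad n x y -> exists i j : bool,
    bad n.+1 (x + i%:R * (w / 2 ^+ n.+1)) (y + j%:R * (h / 2 ^+ n.+1))) ->
  exists x y, forall n, exists a b, [/\ bad n a b,
    a <= x <= a + w / 2 ^+ n & b <= y <= b + h / 2 ^+ n].
Proof.
move=> w0 h0 bad0 step.
have /choice[f fP] (p : nat * R * R) : exists ij : bool * bool,
    bad p.1.1 p.1.2 p.2 -> bad p.1.1.+1
      (p.1.2 + ij.1%:R * (w / 2 ^+ p.1.1.+1))
      (p.2 + ij.2%:R * (h / 2 ^+ p.1.1.+1)).
  have [/step[i [j bij]]|nb] := pselect (bad p.1.1 p.1.2 p.2).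
    by exists (i, j).
  by exists (true, true).
pose F n (q : R * R) := let ij := f (n, q.1, q.2) in
  (q.1 + ij.1%:R * (w / 2 ^+ n.+1), q.2 + ij.2%:R * (h / 2 ^+ n.+1)).
pose z := fix z n := if n is m.+1 then F m (z m) else (x0, y0).
have zbad n : bad n (z n).1 (z n).2.
  by elim: n => // n IH; exact: (fP (n, (z n).1, (z n).2)).
have half (c : R) n : c / 2 ^+ n = c / 2 ^+ n.+1 + c / 2 ^+ n.+1.
  by rewrite exprS; field; rewrite expf_neq0.
have incr (c a : R) (b : bool) n : 0 <= c ->
    a <= a + b%:R * (c / 2 ^+ n.+1) /\
    a + b%:R * (c / 2 ^+ n.+1) + c / 2 ^+ n.+1 <= a + c / 2 ^+ n.
  move=> c0; have : 0 <= c / 2 ^+ n.+1 by rewrite divr_ge0 // exprn_ge0.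
  by rewrite (half c n); case: b; rewrite /= ?mul1r ?mul0r; lra.
have [|x xP] := @nested_intervals R (fun n => (z n).1) w w0.
  by move=> n; exact: incr.
have [|y yP] := @nested_intervals R (fun n => (z n).2) h h0.
  by move=> n; exact: incr.
by exists x, y => n; exists (z n).1, (z n).2; split.
Qed.

Lemma half_pow_small (R : realType) (c e : R) :
  0 < e -> exists n, c / 2 ^+ n < e.
Proof.
move=> e0; exists (Num.truncn (c / e)).+1.
rewrite ltr_pdivrMr ?exprn_gt0 // -ltr_pdivrMl //.
rewrite mulrC (lt_le_trans (Num.Theory.truncnS_gt _)) //.
by rewrite -natrX ler_nat ltnW // ltn_expl.
Qed.

(** Cousin's principle: a property of intervals that is stable under
    concatenation and holds for short intervals around each point holds on the
    whole interval. *)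
Lemma local_to_interval (R : realType) (P : R -> R -> Prop) (a b : R) :
  a <= b ->
  (forall x y z, a <= x -> x <= y -> y <= z -> z <= b ->
    P x y -> P y z -> P x z) ->
  (forall t, a <= t <= b -> exists2 d : R, 0 < d &
    forall x y, a <= x -> x <= t -> t <= y -> y <= b -> y - x < d -> P x y) ->
  P a b.
Proof.
move=> ab Ptr Ploc; apply: contrapT => nP.
pose bad n x (_ : R) := [/\ a <= x, x + (b - a) / 2 ^+ n <= b &
   ~ P x (x + (b - a) / 2 ^+ n)].
have w0 : 0 <= b - a by rewrite subr_ge0.
have wn n : 0 <= (b - a) / 2 ^+ n by rewrite divr_ge0 // exprn_ge0.
have half n : (b - a) / 2 ^+ n = (b - a) / 2 ^+ n.+1 + (b - a) / 2 ^+ n.+1.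
  by rewrite exprS; field; rewrite expf_neq0.
have [|n x y [ax xb nPx]|t [ystar tP]] := @bisection R bad (b - a) 0 a 0 w0 (lexx _).
- by rewrite /bad expr0 divr1 subrKC.
- have := wn n.+1; rewrite half in xb nPx.
  set e := (b - a) / 2 ^+ n.+1 in xb nPx * => e0.
  have [Pl|nPl] := pselect (P x (x + e)).
    exists true, false; rewrite /bad mul1r -/e; split; [lra|lra|] => Pr.
    apply: nPx; apply: (Ptr _ (x + e)); try lra; first exact: Pl.
    by rewrite addrA.
  by exists false, false; rewrite /bad mul0r addr0 -/e; split; [|lra|].
have tab : a <= t <= b.
  have [x [_ [[ax xb _] /andP[xt tx] _]]] := tP 0%N.
  by rewrite (le_trans ax xt) (le_trans tx xb).
have [d d0 Pd] := Ploc _ tab.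
have [n nd] := half_pow_small (b - a) d0.
have [x [_ [[ax xb nPx] /andP[xt tx] _]]] := tP n.
by apply: nPx; apply: Pd => //; rewrite addrC addKr.
Qed.

(** Stated for a pseudo-distance D so that it serves complex valued functions and
    curves in C^n, with one-sided derivatives at the end points. Intervals
    containing t are compared through t itself. *)
Lemma mean_value_le (R : realType) (D : R -> R -> R) (a b M : R) :
  a <= b ->
  (forall x y, D x y = D y x) ->
  (forall x y z, D x z <= D x y + D y z) ->
  (forall t, a <= t <= b -> forall e, 0 < e -> exists2 d : R, 0 < d &
     forall s, a <= s <= b -> `|s - t| < d -> D s t <= (M + e) * `|s - t|) ->
  D a b <= M * (b - a).
Proof.
move=> ab Dsym Dtri Dloc.
apply/ler_addgt0Pr => e e0.
have [e' e'0 e'P] : exists2 e', 0 < e' & e' * (b - a) <= e.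
  exists (e / (b - a + 1)); first by rewrite divr_gt0 //; lra.
  by rewrite mulrAC ler_pdivrMr; nra.
suff : D a b <= (M + e') * (b - a) by nra.
apply: (@local_to_interval R (fun x y => D x y <= (M + e') * (y - x)) a b ab).
  move=> x y z ax xy yz zb Pxy Pyz; apply: le_trans (Dtri x y z) _.
  by apply: le_trans (lerD Pxy Pyz) _; lra.
move=> t tab; have [d d0 Pd] := Dloc t tab e' e'0.
exists d => // x y ax xt ty yb yx.
have xd : `|x - t| < d by rewrite distrC ger0_norm; lra.
have yd : `|y - t| < d by rewrite ger0_norm; lra.
have xab : a <= x <= b by lra.
have yab : a <= y <= b by lra.
have Px := Pd x xab xd; have Py := Pd y yab yd.
rewrite distrC ger0_norm ?subr_ge0 // in Px.
rewrite ger0_norm ?subr_ge0 // in Py.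
apply: le_trans (Dtri x t y) _; rewrite (Dsym t y).
by apply: le_trans (lerD Px Py) _; lra.
Qed.

(** * Closed forms on rectangles *)

Definition continuous_on (R : realType) (a b : R) (f : R -> R) :=
  forall x, a <= x <= b -> {for x, continuous f}.

Definition integral_on (R : realType) (a b : R) (f : R -> R) : R :=
  \int[@lebesgue_measure R]_(x in `[a, b]) f x.

Lemma continuous_on_integrable (R : realType) (a b : R) (f : R -> R) :
  continuous_on a b f -> (@lebesgue_measure R).-integrable `[a, b] (EFin \o f).
Proof.
move=> cf; apply: continuous_compact_integrable; first exact: segment_compact.
apply: continuous_in_subspaceT => x /set_mem /=; rewrite in_itv /=; exact: cf.
Qed.

Lemma integral_on_cat (R : realType) (a c b : R) (f : R -> R) :
  a <= c -> c <= b -> continuous_on a b f ->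
  integral_on a b f = integral_on a c f + integral_on c b f.
Proof.
move=> ac cb cf; have If := continuous_on_integrable cf.
have := @Rintegral_itvB R f (BLeft a) (BRight b) c If.
rewrite !bnd_simp => /(_ ac cb).
rewrite Rintegral_itv_obnd_cbnd => [E|]; first by rewrite /integral_on -E addrC subrK.
apply: integrableS If => //; apply: subset_itv; rewrite bnd_simp //.
Qed.

Lemma integral_onB (R : realType) (a b : R) (f g : R -> R) :
  continuous_on a b f -> continuous_on a b g ->
  integral_on a b (fun x => f x - g x) = integral_on a b f - integral_on a b g.
Proof.
move=> cf cg; rewrite /integral_on RintegralB //; exact: continuous_on_integrable.
Qed.

Lemma integral_on_cst (R : realType) (a b c : R) :
  a <= b -> integral_on a b (fun=> c) = c * (b - a).
Proof.
move=> ab; rewrite /integral_on Rintegral_cst //= lebesgue_measure_itv /= lte_fin.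
move: ab; rewrite le_eqVlt => /predU1P[->|ab]; first by rewrite ltxx /= subrr.
by rewrite ab.
Qed.

Lemma continuous_on_cst (R : realType) (a b c : R) : continuous_on a b (fun=> c).
Proof. by move=> x _; exact: cvg_cst. Qed.

Lemma le_integral_on (R : realType) (a b : R) (f g : R -> R) :
  continuous_on a b f -> continuous_on a b g -> (forall x, a <= x <= b -> f x <= g x) ->
  integral_on a b f <= integral_on a b g.
Proof.
move=> cf cg fg; apply: le_Rintegral => //; try exact: continuous_on_integrable.
Qed.

Lemma integral_on_dist_cst (R : realType) (a b c M : R) (f : R -> R) :
  a <= b -> continuous_on a b f -> (forall x, a <= x <= b -> `|f x - c| <= M) ->
  `|integral_on a b f - c * (b - a)| <= M * (b - a).
Proof.
move=> ab cf fM; rewrite ler_distl -mulrBl -mulrDl -!integral_on_cst //.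
apply/andP; split; apply: le_integral_on => //; try exact: continuous_on_cst.
  by move=> x /fM; rewrite ler_distl => /andP[].
by move=> x /fM; rewrite ler_distl => /andP[].
Qed.

(** Differentiability at a single point; nothing is asked of the partial
    derivatives p and q nearby, which is what Goursat's argument exploits. *)
Definition has_differential (R : realType) (F : R -> R -> R) (x y p q : R) :=
  forall e, 0 < e -> exists2 d : R, 0 < d &
    forall s t, `|s - x| < d -> `|t - y| < d ->
    `|F s t - F x y - p * (s - x) - q * (t - y)| <= e * (`|s - x| + `|t - y|).

Lemma has_differential_continuous (R : realType) (F : R -> R -> R) x y p q :
  has_differential F x y p q ->
  {for x, continuous (F ^~ y)} /\ {for y, continuous (F x)}.
Proof.
move=> /(_ 1 ltr01)[d d0 dP].
have key (u : R) : 0 < `|u| + 1 by rewrite ltr_wpDl.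
split; apply/cvgrPdist_le => /= e e0.
  near=> s; have sd : `|s - x| < d.
    by rewrite distrC; near: s; apply: cvgr_dist_lt.
  have /(dP s y sd) : `|y - y| < d by rewrite subrr normr0.
  rewrite subrr normr0 mulr0 subr0 addr0 mul1r.
  have : (`|p| + 1) * `|s - x| <= e.
    rewrite -ler_pdivlMl // mulrC distrC; near: s.
    by apply: cvgr_dist_le => //; rewrite divr_gt0.
  rewrite (distrC (F x y)) mulrDl mul1r -normrM => ? ?.
  rewrite -(subrK (p * (s - x)) (F s y - F x y)).
  by apply: le_trans (ler_normD _ _) _; rewrite addrC; lra.
near=> t; have td : `|t - y| < d.
  by rewrite distrC; near: t; apply: cvgr_dist_lt.
have /(dP x t) : `|x - x| < d by rewrite subrr normr0.
move=> /(_ td); rewrite subrr normr0 mulr0 subr0 add0r mul1r.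
have : (`|q| + 1) * `|t - y| <= e.
  rewrite -ler_pdivlMl // mulrC distrC; near: t.
  by apply: cvgr_dist_le => //; rewrite divr_gt0.
rewrite (distrC (F x y)) mulrDl mul1r -normrM => ? ?.
rewrite -(subrK (q * (t - y)) (F x t - F x y)).
by apply: le_trans (ler_normD _ _) _; rewrite addrC; lra.
Unshelve. all: by end_near. Qed.

Section Green.
Variables (R : realType) (P Q : R -> R -> R).

(** The integral of P dx + Q dy counterclockwise around [a, b] x [c, d]. *)
Definition circulation (a b c d : R) : R :=
  integral_on a b (P ^~ c) - integral_on a b (P ^~ d) +
  (integral_on c d (Q b) - integral_on c d (Q a)).

(** The shared coefficient q is the closedness condition dP/dy = dQ/dx. *)
Definition closed_at (x y : R) := exists p q r,
  has_differential P x y p q /\ has_differential Q x y q r.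

Let continuous_onP (a b y : R) : (forall x, a <= x <= b -> closed_at x y) ->
  continuous_on a b (P ^~ y).
Proof.
move=> PQ x /PQ[p [q [r [/has_differential_continuous[c _] _]]]]; exact: c.
Qed.

Let continuous_onQ (a b x : R) : (forall y, a <= y <= b -> closed_at x y) ->
  continuous_on a b (Q x).
Proof.
move=> PQ y /PQ[p [q [r [_ /has_differential_continuous[_ c]]]]]; exact: c.
Qed.

Lemma circulation_catl (a m b c d : R) : a <= m <= b -> c <= d ->
  (forall x y, a <= x <= b -> c <= y <= d -> closed_at x y) ->
  circulation a b c d = circulation a m c d + circulation m b c d.
Proof.
move=> /andP[am mb] cd PQ; rewrite /circulation.
rewrite (@integral_on_cat R a m b (P ^~ c)) //; last first.
  by apply: continuous_onP => x xab; apply: PQ => //; rewrite lexx.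
rewrite (@integral_on_cat R a m b (P ^~ d)) //; last first.
  by apply: continuous_onP => x xab; apply: PQ => //; rewrite lexx cd.
ring.
Qed.

Lemma circulation_catr (a b c m d : R) : a <= b -> c <= m <= d ->
  (forall x y, a <= x <= b -> c <= y <= d -> closed_at x y) ->
  circulation a b c d = circulation a b c m + circulation a b m d.
Proof.
move=> ab /andP[cm md] PQ; rewrite /circulation.
rewrite (@integral_on_cat R c m d (Q a)) //; last first.
  by apply: continuous_onQ => x xab; apply: PQ => //; rewrite lexx.
rewrite (@integral_on_cat R c m d (Q b)) //; last first.
  by apply: continuous_onQ => x xab; apply: PQ => //; rewrite lexx ab.
ring.
Qed.

(** The differentials of P and Q contribute q (c - d) (b - a) and
    q (b - a) (d - c), which cancel; only the remainders are left. *)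
Lemma circulation_local (x y : R) : closed_at x y -> forall e, 0 < e ->
  exists2 dl : R, 0 < dl & forall a b c d,
    (forall s t, a <= s <= b -> c <= t <= d -> closed_at s t) ->
    a <= x <= b -> c <= y <= d -> b - a < dl -> d - c < dl ->
    `|circulation a b c d| <= e * (b - a + (d - c)) ^+ 2.
Proof.
move=> [p [q [r [dP dQ]]]] e e0.
have e20 : 0 < e / 2 by rewrite divr_gt0.
have [d1 d10 dP1] := dP _ e20; have [d2 d20 dQ2] := dQ _ e20.
exists (Num.min d1 d2); first by rewrite lt_min d10.
move=> a b c d PQ xab ycd; rewrite !lt_min => /andP[ab1 ab2] /andP[cd1 cd2].
have ab : a <= b by lra.
have cd : c <= d by lra.
have cP t : c <= t <= d -> continuous_on a b (P ^~ t).
  by move=> tcd; apply: continuous_onP => s sab; exact: PQ.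
have cQ s : a <= s <= b -> continuous_on c d (Q s).
  by move=> sab; apply: continuous_onQ => t tcd; exact: PQ.
have cc : c <= c <= d by rewrite lexx.
have dd : c <= d <= d by rewrite lexx andbT.
have aa : a <= a <= b by rewrite lexx.
have bb : a <= b <= b by rewrite lexx andbT.
set l := b - a + (d - c).
have near_s s dl : a <= s <= b -> b - a < dl -> `|s - x| < dl /\ `|s - x| <= b - a.
  by move=> sab abdl; have : `|s - x| <= b - a; [rewrite ler_distl; lra|lra].
have near_t t dl : c <= t <= d -> d - c < dl -> `|t - y| < dl /\ `|t - y| <= d - c.
  by move=> sab abdl; have : `|t - y| <= d - c; [rewrite ler_distl; lra|lra].
have HP : `|integral_on a b (P ^~ c) - integral_on a b (P ^~ d) -
    q * (c - d) * (b - a)| <= e * l * (b - a).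
  rewrite -integral_onB; [|exact: cP|exact: cP].
  apply: integral_on_dist_cst => //.
    by move=> s sab; apply: continuousB; [exact: cP|exact: cP].
  move=> s sab.
  have [s1 s2] := near_s s d1 sab ab1.
  have [t1 t2] := near_t c d1 cc cd1.
  have [u1 u2] := near_t d d1 dd cd1.
  have := dP1 s c s1 t1; have := dP1 s d s1 u1.
  set A := _ - q * (d - y); set B := _ - q * (c - y) => hA hB.
  have -> : P s c - P s d - q * (c - d) = B - A by rewrite /A /B; ring.
  by apply: le_trans (ler_normB _ _) _; rewrite /l; nra.
have HQ : `|integral_on c d (Q b) - integral_on c d (Q a) - q * (b - a) * (d - c)| <=
    e * l * (d - c).
  rewrite -integral_onB; [|exact: cQ|exact: cQ].
  apply: integral_on_dist_cst => //.
    by move=> s sab; apply: continuousB; [exact: cQ|exact: cQ].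
  move=> t tcd.
  have [t1 t2] := near_t t d2 tcd cd2.
  have [s1 s2] := near_s a d2 aa ab2.
  have [u1 u2] := near_s b d2 bb ab2.
  have := dQ2 a t s1 t1; have := dQ2 b t u1 t1.
  set A := _ - r * (t - y); set B := _ - r * (t - y) => hA hB.
  have -> : Q b t - Q a t - q * (b - a) = A - B by rewrite /A /B; ring.
  by apply: le_trans (ler_normB _ _) _; rewrite /l; nra.
rewrite /circulation.
set A := integral_on a b _ - _ in HP *; set B := integral_on c d _ - _ in HQ *.
have -> : A + B = (A - q * (c - d) * (b - a)) + (B - q * (b - a) * (d - c)).
  by ring.
apply: le_trans (ler_normD _ _) _; rewrite expr2 /l in HP HQ *; nra.
Qed.

(** Goursat's argument: circulation is additive under subdivision, so a
    circulation larger than e times the square of the half-perimeter would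
    survive bisection and contradict the local estimate at the limit point. *)
Lemma circulation_eq0 (a b c d : R) : a <= b -> c <= d ->
  (forall x y, a <= x <= b -> c <= y <= d -> closed_at x y) ->
  circulation a b c d = 0.
Proof.
move=> ab cd PQ; apply/eqP; rewrite -normr_le0; apply/ler_addgt0Pr => e0 e00.
rewrite add0r.
set w := b - a; set h := d - c; set l := w + h.
have w0 : 0 <= w by rewrite subr_ge0.
have h0 : 0 <= h by rewrite subr_ge0.
have [e e_gt0 ee] : exists2 e : R, 0 < e & e * l ^+ 2 <= e0.
  exists (e0 / (l ^+ 2 + 1)).
    by rewrite divr_gt0 // ltr_wpDl // sqr_ge0.
  by rewrite mulrAC ler_pdivrMr ?ltr_wpDl ?sqr_ge0 //; nra.
apply: le_trans ee; rewrite leNgt; apply/negP => big.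
(* Side of length u after n bisections. *)
pose wn (u : R) n := u / 2 ^+ n.
have wn0 u n : 0 <= u -> 0 <= wn u n.
  by move=> u0; rewrite /wn divr_ge0 // exprn_ge0.
have half u n : wn u n = wn u n.+1 + wn u n.+1.
  by rewrite /wn exprS; field; rewrite expf_neq0.
pose bad n x y := [/\ a <= x /\ x + wn w n <= b, c <= y /\ y + wn h n <= d &
  e * (wn w n + wn h n) ^+ 2 <
     `|circulation x (x + wn w n) y (y + wn h n)|].
have [||x [y xyP]] := @bisection R bad w h a c w0 h0.
- by rewrite /bad /wn expr0 !divr1 /w /h !subrKC; split.
- move=> n x y [[ax xb] [cy yd] nbig].
  have := wn0 w n.+1 w0; have := wn0 h n.+1 h0.
  rewrite !(half _ n) in xb yd nbig.
  rewrite /bad -/(wn w n.+1) -/(wn h n.+1).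
  set w' := wn w n.+1 in xb nbig *; set h' := wn h n.+1 in yd nbig *.
  move=> h'0 w'0; apply: contrapT => nb.
  have small (i j : bool) :
      `|circulation (x + i%:R * w') (x + i%:R * w' + w')
         (y + j%:R * h') (y + j%:R * h' + h')| <= e * (w' + h') ^+ 2.
    rewrite leNgt; apply/negP => bg; apply: nb; exists i, j; split => //.
      by case: i {bg} => /=; rewrite ?mul1r ?mul0r; lra.
    by case: j {bg} => /=; rewrite ?mul1r ?mul0r; lra.
  move: nbig.
  rewrite (@circulation_catl x (x + w')); [|lra|lra|]; last first.
    by move=> s t ? ?; apply: PQ; lra.
  rewrite (@circulation_catr x _ _ (y + h')); [|lra|lra|]; last first.
    by move=> s t ? ?; apply: PQ; lra.
  rewrite (@circulation_catr (x + w') _ _ (y + h')); [|lra|lra|]; last first.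
    by move=> s t ? ?; apply: PQ; lra.
  have := small false false; have := small false true.
  have := small true false; have := small true true.
  rewrite /= !mul1r !mul0r !addr0 !(addrA x) !(addrA y) expr2.
  set A := circulation x (x + w') y _; set B := circulation x (x + w') (y + h') _.
  set C := circulation (x + w') _ y _; set E := circulation (x + w') _ (y + h') _.
  move=> hE hC hB hA; apply/negP; rewrite -leNgt.
  have := ler_normD (A + B) (C + E); have := ler_normD C E.
  have := ler_normD A B; nra.
have xy0 : closed_at x y.
  have [x' [y' [[[? ?] [? ?] _] /andP[? ?] /andP[? ?]]]] := xyP 0%N.
  by apply: PQ; apply/andP; split;
    [apply: le_trans; eassumption|apply: le_trans; eassumption|
     apply: le_trans; eassumption|apply: le_trans; eassumption].
have [dl dl0 loc] := circulation_local xy0 e_gt0.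
have [n nd] := half_pow_small l dl0.
have [x' [y' [[[ax xb] [cy yd] nbig] xx yy]]] := xyP n.
have ln : l / 2 ^+ n = wn w n + wn h n by rewrite /wn -mulrDl.
have := wn0 w n w0; have := wn0 h n h0 => h'0 w'0.
move: nbig; rewrite ltNge => /negP; apply.
have -> : wn w n + wn h n = x' + wn w n - x' + (y' + wn h n - y') by ring.
apply: loc => //; [|lra|lra].
by move=> s t ? ?; apply: PQ; lra.
Qed.

End Green.

(** * Cauchy's estimate *)

Lemma normr_Re (R : rcfType) (z : R[i]) : `|complex.Re z| <= cabs z.
Proof. by case: z => a b /=; rewrite -sqrtr_sqr ler_sqrt ?lerDl ?addr_ge0 ?sqr_ge0. Qed.

Lemma normr_Im (R : rcfType) (z : R[i]) : `|complex.Im z| <= cabs z.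
Proof. by case: z => a b /=; rewrite -sqrtr_sqr ler_sqrt ?lerDr ?addr_ge0 ?sqr_ge0. Qed.

Lemma cabs_ge0 (R : rcfType) (z : R[i]) : 0 <= cabs z.
Proof. by case: z => a b /=; exact: sqrtr_ge0. Qed.

Lemma cabsD (R : rcfType) (z w : R[i]) : cabs (z + w) <= cabs z + cabs w.
Proof. exact: le_normcD. Qed.

Lemma cabsN (R : rcfType) (z : R[i]) : cabs (- z) = cabs z.
Proof. exact: normcN. Qed.

Lemma cabsB (R : rcfType) (z w : R[i]) : cabs (z - w) <= cabs z + cabs w.
Proof. by rewrite (le_trans (cabsD _ _)) // cabsN. Qed.

Lemma cabsBC (R : rcfType) (z w : R[i]) : cabs (z - w) = cabs (w - z).
Proof. by rewrite -cabsN opprB. Qed.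

Lemma cabsM (R : rcfType) (z w : R[i]) : cabs (z * w) = cabs z * cabs w.
Proof. exact: ComplexField.Normc.normcM. Qed.

Lemma cabs_real (R : rcfType) (x : R) : cabs x%:C = `|x|.
Proof. by rewrite /= expr0n addr0 sqrtr_sqr. Qed.

Lemma cabs0 (R : rcfType) : cabs (0 : R[i]) = 0.
Proof. exact: ComplexField.Normc.normc0. Qed.

Lemma cabs_le_ReIm (R : rcfType) (z : R[i]) :
  cabs z <= `|complex.Re z| + `|complex.Im z|.
Proof.
rewrite -(ger0_norm (addr_ge0 (normr_ge0 (complex.Re z)) (normr_ge0 (complex.Im z)))).
case: z => a b /=; rewrite -sqrtr_sqr ler_sqrt ?sqr_ge0 //.
rewrite -[a ^+ 2]real_normK ?num_real // -[b ^+ 2]real_normK ?num_real //.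
have := normr_ge0 a; have := normr_ge0 b; rewrite !expr2; nra.
Qed.

(** Complex differentiability at one point, with no continuity of the derivative. *)
Definition cderiv (R : realType) (f : R[i] -> R[i]) (w d : R[i]) :=
  forall e, 0 < e -> exists2 dl : R, 0 < dl & forall h, cabs h < dl ->
    cabs (f (w + h) - f w - d * h) <= e * cabs h.

Lemma cderiv_cont (R : realType) (f : R[i] -> R[i]) (w d : R[i]) :
  cderiv f w d -> exists2 dl : R, 0 < dl & forall h, cabs h < dl ->
    cabs (f (w + h) - f w) <= (cabs d + 1) * cabs h.
Proof.
move=> /(_ 1 ltr01)[dl dl0 dlP]; exists dl => // h /dlP H.
have -> : f (w + h) - f w = (f (w + h) - f w - d * h) + d * h by ring.
by apply: le_trans (cabsD _ _) _; rewrite cabsM; lra.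
Qed.

Lemma cderiv_comp (R : realType) (f g : R[i] -> R[i]) (w c d : R[i]) :
  cderiv g w c -> cderiv f (g w) d -> cderiv (f \o g) w (d * c).
Proof.
move=> dg df e e0; have [d1 d10 P1] := cderiv_cont dg.
set C := cabs c + 1 in P1; set D := cabs d + 1.
have C0 : 0 < C by rewrite ltr_wpDl ?cabs_ge0.
have D0 : 0 < D by rewrite ltr_wpDl ?cabs_ge0.
have [d2 d20 P2] := dg (e / 2 / D) (divr_gt0 (divr_gt0 e0 (ltr0n _ 2)) D0).
have [d3 d30 P3] := df (e / 2 / C) (divr_gt0 (divr_gt0 e0 (ltr0n _ 2)) C0).
exists (Num.min d1 (Num.min d2 (d3 / C))).
  by rewrite !lt_min d10 d20 divr_gt0.
move=> h; rewrite !lt_min ltr_pdivlMr // => /andP[h1 /andP[h2 h3]].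
set k := g (w + h) - g w.
have kC : cabs k <= C * cabs h by exact: P1.
have kd : cabs k < d3 by rewrite (le_lt_trans kC) // mulrC.
have -> : (f \o g) (w + h) - (f \o g) w - d * c * h =
    (f (g w + k) - f (g w) - d * k) + d * (k - c * h).
  by rewrite /= /k subrKC; ring.
apply: le_trans (cabsD _ _) _; rewrite cabsM.
have H3 := P3 _ kd; have H2 := P2 _ h2.
rewrite -/k in H2; have h0 := cabs_ge0 h.
have E3 : e / 2 / C * cabs k <= e / 2 * cabs h.
  by rewrite -mulrA ler_pM2l ?divr_gt0 // mulrC ler_pdivrMr // mulrC.
have E2 : cabs d * cabs (k - c * h) <= e / 2 * cabs h.
  apply: (@le_trans _ _ (D * (e / 2 / D * cabs h))).
    by apply: ler_pM => //; rewrite ?cabs_ge0 // /D lerDl.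
  by rewrite mulrA (mulrC D) divfK // gt_eqF.
apply: le_trans (lerD (le_trans H3 E3) E2) _; lra.
Qed.

Lemma cderiv_mul (R : realType) (f g : R[i] -> R[i]) (w c d : R[i]) :
  cderiv f w c -> cderiv g w d ->
  cderiv (fun z => f z * g z) w (c * g w + f w * d).
Proof.
move=> df dg e e0; have [d1 d10 P1] := cderiv_cont dg.
set D := cabs d + 1 in P1; set G := cabs (g w) + D; set F := cabs (f w) + 1.
have D0 : 0 < D by rewrite ltr_wpDl ?cabs_ge0.
have G0 : 0 < G by rewrite ltr_wpDl ?cabs_ge0.
have F0 : 0 < F by rewrite ltr_wpDl ?cabs_ge0.
have e3 : 0 < e / 3 by rewrite divr_gt0.
have [d2 d20 P2] := df _ (divr_gt0 e3 G0).
have [d3 d30 P3] := dg _ (divr_gt0 e3 F0).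
have cD0 : 0 < (cabs c + 1) * D by rewrite mulr_gt0 // ltr_wpDl ?cabs_ge0.
exists (Num.min 1 (Num.min (Num.min d1 d2) (Num.min d3 (e / 3 / ((cabs c + 1) * D))))).
  by rewrite !lt_min d10 d20 d30 ltr01 divr_gt0.
move=> h; rewrite !lt_min => /andP[hh1 /andP[/andP[h1 h2] /andP[h3]]].
rewrite ltr_pdivlMr // => h4.
have -> : f (w + h) * g (w + h) - f w * g w - (c * g w + f w * d) * h =
  (f (w + h) - f w - c * h) * g (w + h) + f w * (g (w + h) - g w - d * h)
   + c * h * (g (w + h) - g w) by ring.
have h0 := cabs_ge0 h.
have H1 := P1 _ h1; have H2 := P2 _ h2; have H3 := P3 _ h3.
have gb : cabs (g (w + h)) <= G.
  rewrite -(subrK (g w) (g (w + h))) addrC; apply: le_trans (cabsD _ _) _.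
  by rewrite lerD2l (le_trans H1) // ler_piMr // ltW.
apply: le_trans (cabsD _ _) _; apply: le_trans (lerD (cabsD _ _) (lexx _)) _.
rewrite !cabsM.
have E1 : cabs (f (w + h) - f w - c * h) * cabs (g (w + h)) <= e / 3 * cabs h.
  apply: (@le_trans _ _ (e / 3 / G * cabs h * G)).
    by apply: ler_pM; rewrite ?cabs_ge0.
  by rewrite mulrAC divfK // gt_eqF.
have E2 : cabs (f w) * cabs (g (w + h) - g w - d * h) <= e / 3 * cabs h.
  apply: (@le_trans _ _ (F * (e / 3 / F * cabs h))).
    by apply: ler_pM; rewrite ?cabs_ge0 // /F lerDl.
  by rewrite mulrA (mulrC F) divfK // gt_eqF.
have E3 : cabs c * cabs h * cabs (g (w + h) - g w) <= e / 3 * cabs h.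
  apply: (@le_trans _ _ ((cabs c + 1) * cabs h * (D * cabs h))).
    by apply: ler_pM; rewrite ?mulr_ge0 ?cabs_ge0 // ler_wpM2r // lerDl.
  have : (cabs c + 1) * cabs h * (D * cabs h) =
         cabs h * ((cabs c + 1) * D) * cabs h by ring.
  by move=> ->; rewrite ler_wpM2r // ltW.
by apply: le_trans (lerD (lerD E1 E2) E3) _; lra.
Qed.

Lemma cderiv_sub_cst (R : realType) (f : R[i] -> R[i]) w d c :
  cderiv f w d -> cderiv (fun z => f z - c) w d.
Proof.
move=> df e /df[dl dl0 P]; exists dl => // h /P.
by congr (cabs _ <= _); ring.
Qed.

Lemma cderiv_opp (R : realType) (w : R[i]) : cderiv (fun z => - z) w (-1).
Proof.
move=> e e0; exists 1 => // h _.
have -> : - (w + h) - - w - -1 * h = 0 by ring.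
by rewrite cabs0 mulr_ge0 ?cabs_ge0 // ltW.
Qed.

(** The remainder form of derivability, also valid at h = 0. *)
Lemma derivable_eps (R : realType) (f : R -> R) (x : R) :
  derivable f x 1 -> forall e, 0 < e -> exists2 d : R, 0 < d & forall h,
  `|h| < d -> `|f (x + h) - f x - derive1 f x * h| <= e * `|h|.
Proof.
move=> df e e0; rewrite derive1E.
have /cvgrPdist_le /(_ e e0) := df.
rewrite /dnbhs; rewrite near_withinE => /nbhs_normP[d /= d0 dP].
exists d => // h hd; have [->|hn0] := eqVneq h 0.
  by rewrite addr0 mulr0 subr0 subrr normr0 mulr0.
have := dP h; rewrite /= sub0r normrN => /(_ hd hn0).
rewrite -[X in `|X - _|]/('D_1 f x) distrC scaler1 (addrC h) => H.
have -> : f (x + h) - f x - 'D_1 f x * h =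
   (h^-1 *: (f (x + h) - f x) - 'D_1 f x) * h.
  by rewrite /GRing.scale /= mulrBl mulrAC mulVf // mul1r.
by rewrite normrM ler_wpM2r.
Qed.

Section ComplexExp.
Variable R : realType.

Definition cexp (z : R[i]) : R[i] :=
  (expR (complex.Re z) * cos (complex.Im z)) +i*
  (expR (complex.Re z) * sin (complex.Im z)).

Lemma cexpD (z w : R[i]) : cexp (z + w) = cexp z * cexp w.
Proof.
case: z w => [a b] [c d]; rewrite /cexp /= expRD cosD sinD.
by apply/eqP; rewrite eq_complex /=; apply/andP; split; apply/eqP; ring.
Qed.

Lemma cexp0 : cexp 0 = 1.
Proof. by rewrite /cexp /= expR0 cos0 sin0 mulr1 mulr0. Qed.

Lemma cabs_cexp (z : R[i]) : cabs (cexp z) = expR (complex.Re z).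
Proof.
rewrite /cexp /= !exprMn -mulrDr cos2Dsin2 mulr1 sqrtr_sqr.
by rewrite ger0_norm // expR_ge0.
Qed.

Lemma cexpN (z : R[i]) : cexp z * cexp (- z) = 1.
Proof. by rewrite -cexpD subrr cexp0. Qed.

Lemma cexp_periodic (s : R) : cexp (s +i* (2 * pi)) = cexp (s +i* 0).
Proof.
by rewrite /cexp /= mulr_natl cos2pi sin2pi cos0 sin0.
Qed.

Lemma cderiv_cexp0 : cderiv cexp 0 1.
Proof.
move=> e0 e00.
(* Nine is the number of terms of size e * h collected at the end. *)
have [e e_gt0 [e1 ee]] : exists2 e : R, 0 < e & e <= 1 /\ 9 * e <= e0.
  exists (Num.min 1 (e0 / 9)); first by rewrite lt_min ltr01 divr_gt0.
  split; first by rewrite ge_min lexx.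
  have : Num.min 1 (e0 / 9) <= e0 / 9 by rewrite ge_min lexx orbT.
  lra.
have [d1 d10 P1] := @derivable_eps R expR 0 (@derivable_expR R 0) _ e_gt0.
have [d2 d20 P2] := @derivable_eps R sin 0 (@derivable_sin R 0) _ e_gt0.
have [d3 d30 P3] := @derivable_eps R cos 0 (@derivable_cos R 0) _ e_gt0.
exists (Num.min e (Num.min d1 (Num.min d2 d3))) => [|[a b]].
  by rewrite !lt_min e_gt0 d10 d20.
rewrite !lt_min => /andP[he /andP[h1 /andP[h2 h3]]].
have ha := normr_Re (a +i* b); have hb := normr_Im (a +i* b).
set h := cabs _ in he h1 h2 h3 ha hb *; rewrite /= in ha hb.
have := P1 a (le_lt_trans ha h1); have := P2 b (le_lt_trans hb h2).
have := P3 b (le_lt_trans hb h3).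
rewrite !add0r !derive1E !derive_val expR0 sin0 cos0 subr0 !mul1r oppr0 mul0r subr0.
move=> Ec Es Ee.
rewrite cexp0 /cexp.
set z := _ - _ - _; apply: le_trans (cabs_le_ReIm z) _; rewrite {}/z /=.
rewrite !subr0.
have -> : expR a * cos b - 1 - a = (expR a - 1 - a) + expR a * (cos b - 1) by ring.
have -> : expR a * sin b - b = expR a * (sin b - b) + (expR a - 1) * b by ring.
have Ea : `|expR a - 1| <= 2 * `|a|.
  have -> : expR a - 1 = (expR a - 1 - a) + a by ring.
  by apply: le_trans (ler_normD _ _) _; have := normr_ge0 a; nra.
have Ea3 : `|expR a| <= 3.
  rewrite -(subrK 1 (expR a)) (le_trans (ler_normD _ _)) // normr1; lra.
apply: le_trans (lerD (ler_normD _ _) (ler_normD _ _)) _; rewrite !normrM.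
have [na nb] := (normr_ge0 a, normr_ge0 b).
have A1 : `|expR a| * `|cos b - 1| <= 3 * (e * h).
  by apply: ler_pM => //; apply: le_trans Ec _; rewrite ler_wpM2l // ltW.
have A2 : `|expR a| * `|sin b - b| <= 3 * (e * h).
  by apply: ler_pM => //; apply: le_trans Es _; rewrite ler_wpM2l // ltW.
have A3 : `|expR a - 1| * `|b| <= 2 * h * e.
  by apply: ler_pM => //; [apply: le_trans Ea _; rewrite ler_wpM2l|lra].
have A4 : `|expR a - 1 - a| <= e * h.
  by apply: le_trans Ee _; rewrite ler_wpM2l // ltW.
have : 9 * e * h <= e0 * h by rewrite ler_wpM2r // (le_trans na).
by lra.
Qed.

Lemma cderiv_cexp (z : R[i]) : cderiv cexp z (cexp z).
Proof.
move=> e e0; have C0 : 0 < cabs (cexp z) by rewrite cabs_cexp expR_gt0.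
have [d d0 P] := cderiv_cexp0 (divr_gt0 e0 C0).
exists d => // h /P; rewrite add0r cexp0 mul1r cexpD => H.
have -> : cexp z * cexp h - cexp z - cexp z * h = cexp z * (cexp h - 1 - h).
  by ring.
by rewrite cabsM mulrC -ler_pdivlMr // mulrAC.
Qed.

End ComplexExp.

Lemma cderiv_has_differential (R : realType) (g : R[i] -> R[i]) (s t : R) d :
  cderiv g (s +i* t) d ->
  has_differential (fun s t => complex.Im (g (s +i* t))) s t
    (complex.Im d) (complex.Re d) /\
  has_differential (fun s t => complex.Re (g (s +i* t))) s t
    (complex.Re d) (- complex.Im d).
Proof.
move=> dg; split=> e e0; have [dl dl0 P] := dg e e0;
  exists (dl / 2); rewrite ?divr_gt0 // => s' t' hs ht.
- have hle := cabs_le_ReIm ((s' - s) +i* (t' - t)); rewrite /= in hle.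
  have hh : cabs ((s' - s) +i* (t' - t)) < dl by rewrite (le_lt_trans hle) //; lra.
  apply: le_trans (le_trans (P _ hh) (ler_wpM2l (ltW e0) hle)).
  have -> : (s +i* t) + ((s' - s) +i* (t' - t)) = s' +i* t' :> R[i].
    by apply/eqP; rewrite eq_complex /= !subrKC !eqxx.
  apply: le_trans (normr_Im _).
  case: (g (s' +i* t')) (g (s +i* t)) d {dg P} => [a b] [a' b'] [c c'] /=.
  by rewrite le_eqVlt; apply/orP; left; apply/eqP; congr `|_|; ring.
- have hle := cabs_le_ReIm ((s' - s) +i* (t' - t)); rewrite /= in hle.
  have hh : cabs ((s' - s) +i* (t' - t)) < dl by rewrite (le_lt_trans hle) //; lra.
  apply: le_trans (le_trans (P _ hh) (ler_wpM2l (ltW e0) hle)).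
  have -> : (s +i* t) + ((s' - s) +i* (t' - t)) = s' +i* t' :> R[i].
    by apply/eqP; rewrite eq_complex /= !subrKC !eqxx.
  apply: le_trans (normr_Re _).
  case: (g (s' +i* t')) (g (s +i* t)) d {dg P} => [a b] [a' b'] [c c'] /=.
  by rewrite le_eqVlt; apply/orP; left; apply/eqP; congr `|_|; ring.
Qed.

(** The function g z = (f (exp z) - f 0) exp (- z) is complex differentiable for
    Re z <= ln r, so the form Im (g dz) is closed. On a rectangle of height 2 pi
    the horizontal sides cancel by periodicity, hence the mean of Re g over a
    vertical side is independent of its abscissa. It tends to Re d as the
    abscissa goes to - infinity, and is at most M / r at abscissa ln r. *)
Lemma cauchy_estimate_Re (R : realType) (f : R[i] -> R[i]) (d : R[i]) (r M : R) :
  0 < r -> cderiv f 0 d -> (forall w, cabs w <= r -> exists d, cderiv f w d) ->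
  (forall w, cabs w <= r -> cabs (f w - f 0) <= M) ->
  complex.Re d <= M / r.
Proof.
move=> r0 df0 df fM; rewrite leNgt; apply/negP => big.
pose e := (complex.Re d - M / r) / 2.
have e0 : 0 < e by rewrite divr_gt0 // subr_gt0.
have [dl dl0 P] := df0 _ e0.
pose m := Num.min (dl / 2) r.
have m0 : 0 < m by rewrite lt_min r0 divr_gt0.
have mr : m <= r by rewrite ge_min lexx orbT.
have mdl : m < dl.
  by have : m <= dl / 2; [rewrite ge_min lexx|lra].
pose g z := (f (cexp z) - f 0) * cexp (- z).
have dg s t : s <= ln r -> exists d', cderiv g (s +i* t) d'.
  move=> sr; have [|d' dd'] := df (cexp (s +i* t)).
    by rewrite cabs_cexp /= -[leRHS]lnK // ler_expR.
  eexists; apply: (@cderiv_mul R (fun z => f (cexp z) - f 0) (fun z => cexp (- z))).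
    apply: (@cderiv_sub_cst R (fun z => f (cexp z))).
    exact: (@cderiv_comp R f (@cexp R) _ _ _ (@cderiv_cexp R _) dd').
  exact: (@cderiv_comp R (@cexp R) (fun z => - z) _ _ _ (@cderiv_opp R _)
    (@cderiv_cexp R _)).
pose Q (s t : R) := complex.Re (g (s +i* t)).
pose Pm (s t : R) := complex.Im (g (s +i* t)).
have clo s t : s <= ln r -> closed_at Pm Q s t.
  move=> /(dg s t)[d' /cderiv_has_differential[h1 h2]].
  by exists (complex.Im d'), (complex.Re d'), (- complex.Im d').
have lnm : ln m <= ln r by rewrite ler_ln.
have pi2 : 0 <= 2 * pi :> R by rewrite mulr_ge0 // pi_ge0.
(* g dz = (Q + i Pm) (ds + i dt) has imaginary part Pm ds + Q dt. *)
have C0 : circulation Pm Q (ln m) (ln r) 0 (2 * pi) = 0.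
  by apply: circulation_eq0 => // s t /andP[_ sr] _; exact: clo.
have per s : Pm s (2 * pi) = Pm s 0.
  rewrite /Pm /g cexp_periodic; congr (complex.Im (_ * _)).
  have nz z : cexp z != 0 :> R[i].
    apply/eqP => z0.
    by have := cexpN z; rewrite z0 mul0r => /eqP; rewrite eq_sym oner_eq0.
  have inv z : cexp (- z) = (cexp z)^-1 :> R[i].
    by apply: (mulfI (nz z)); rewrite cexpN divff.
  by rewrite !inv cexp_periodic.
move: C0; rewrite /circulation.
have -> : Pm^~ (2 * pi) = Pm ^~ 0 by apply/funext => s; exact: per.
rewrite subrr add0r -integral_onB; first last.
- by move=> t _; have [p [q [w [_ /has_differential_continuous[_ H]]]]] := clo (ln m) t lnm.
- by move=> t _; have [p [q [w [_ /has_differential_continuous[_ H]]]]] := clo (ln r) t (lexx _).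
have icQ s : s <= ln r -> continuous_on 0 (2 * pi) (Q s).
  by move=> sr t _; have [p [q [w [_ /has_differential_continuous[_ H]]]]] := clo s t sr.
have key : integral_on 0 (2 * pi) (fun t => Q (ln r) t - Q (ln m) t) <=
           integral_on 0 (2 * pi) (fun=> - e).
  apply: le_integral_on; [|exact: continuous_on_cst|] => t tI.
    by apply: continuousB; [exact: (icQ _ (lexx _) t tI)|exact: (icQ _ lnm t tI)].
  have M1 : Q (ln r) t <= M / r.
    apply: le_trans (ler_norm _) (le_trans (normr_Re _) _).
    rewrite /g cabsM cabs_cexp /= expRN lnK //.
    by rewrite ler_pM2r ?invr_gt0 // fM // cabs_cexp /= lnK.
  have M2 : complex.Re d - e <= Q (ln m) t.
    have -> : Q (ln m) t = complex.Re d + complex.Re (g (ln m +i* t) - d).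
      by rewrite /Q; case: (g _) (d) => [? ?] [? ?] /=; rewrite subrKC.
    rewrite lerD2l lerNl; apply: le_trans (ler_norm _) _; rewrite normrN.
    apply: le_trans (normr_Re _) _.
    set z := ln m +i* t.
    have cz : cabs (cexp z) = m by rewrite cabs_cexp /= lnK.
    have := P (cexp z); rewrite cz add0r => /(_ mdl) H.
    have -> : g z - d = (f (cexp z) - f 0 - d * cexp z) * cexp (- z).
      by rewrite mulrBl -mulrA cexpN mulr1.
    rewrite cabsM cabs_cexp /= expRN lnK // ler_pdivrMr //.
  rewrite /e in M2 *; lra.
move=> E; move: key; rewrite E integral_on_cst // subr0 mulNr leNgt oppr_lt0.
by rewrite mulr_gt0 // mulr_gt0 // pi_gt0.
Qed.

(** Rotating f makes its derivative at 0 a nonnegative real. *)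
Lemma cauchy_estimate (R : realType) (f : R[i] -> R[i]) (d : R[i]) (r M : R) :
  0 < r -> cderiv f 0 d -> (forall w, cabs w <= r -> exists d, cderiv f w d) ->
  (forall w, cabs w <= r -> cabs (f w - f 0) <= M) ->
  cabs d <= M / r.
Proof.
move=> r0 df0 df fM.
have M0 : 0 <= M.
  by have := fM 0; rewrite cabs0 => /(_ (ltW r0)); apply: le_trans; exact: cabs_ge0.
have [->|d0] := eqVneq d 0; first by rewrite cabs0 divr_ge0 // ltW.
have cd0 : cabs d != 0 by apply: contra_neq d0; exact: ComplexField.Normc.eq0_normc.
pose u := (conjc d) / (cabs d)%:C.
have ud : u * d = (cabs d)%:C.
  have cdc : (cabs d)%:C != 0 :> R[i].
    by apply: contra_neq cd0 => /(congr1 (@complex.Re R)).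
  rewrite /u mulrAC; apply: (mulIf cdc); rewrite divfK //.
  case: (d) => a b /=; rewrite -rmorphM /= -expr2 sqr_sqrtr ?addr_ge0 ?sqr_ge0 //.
  by apply/eqP; rewrite eq_complex /=; apply/andP; split; apply/eqP; ring.
have cu : cabs u = 1.
  have := congr1 (fun z => cabs z) ud; rewrite cabsM cabs_real ger0_norm ?cabs_ge0 //.
  by move=> /eqP; rewrite -subr_eq0 -[X in _ - X]mul1r -mulrBl mulf_eq0 (negPf cd0) orbF subr_eq0 => /eqP.
have uM w c : cderiv f w c -> cderiv (fun z => u * f z) w (u * c).
  move=> dfw e e0; have [dl dl0 P] := dfw _ e0; exists dl => // h /P.
  have -> : u * f (w + h) - u * f w - u * c * h = u * (f (w + h) - f w - c * h) by ring.
  by rewrite cabsM cu mul1r.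
have := @cauchy_estimate_Re R (fun z => u * f z) (u * d) r M r0 (uM _ _ df0).
rewrite ud /=; apply.
  by move=> w /df[c /uM ?]; exists (u * c).
by move=> w /fM; rewrite -mulrBr cabsM cu mul1r.
Qed.

(** * Euclidean geometry of complex space *)

Section EuclideanTheory.
Variables (R : realType) (n : nat).
Local Notation Cn := 'rV[R[i]]_n.
Implicit Types (v w u : Cn) (x y : R) (c : R[i]).

Lemma rdotC v w : rdot v w = rdot w v.
Proof. by apply: eq_bigr => j _; rewrite !(mulrC (_ (v _ _))). Qed.

Lemma rdotDl u v w : rdot (u + v) w = rdot u w + rdot v w.
Proof.
rewrite /rdot -big_split; apply: eq_bigr => j _; rewrite mxE.
by case: (u 0 j) (v 0 j) => [a b] [a' b'] /=; ring.
Qed.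

Lemma rdotZl x v w : rdot (x%:C *: v) w = x * rdot v w.
Proof.
rewrite /rdot mulr_sumr; apply: eq_bigr => j _; rewrite mxE.
by case: (v 0 j) => [a b] /=; ring.
Qed.

Lemma rdotNl v w : rdot (- v) w = - rdot v w.
Proof.
by rewrite /rdot -sumrN; apply: eq_bigr => j _; rewrite mxE; case: (v 0 j) => [a b] /=; ring.
Qed.

Lemma rdotBl u v w : rdot (u - v) w = rdot u w - rdot v w.
Proof. by rewrite rdotDl rdotNl. Qed.

Lemma rdotDr u v w : rdot u (v + w) = rdot u v + rdot u w.
Proof. by rewrite rdotC rdotDl !(rdotC u). Qed.

Lemma rdotZr x v w : rdot v (x%:C *: w) = x * rdot v w.
Proof. by rewrite rdotC rdotZl rdotC. Qed.

Lemma rdotNr v w : rdot v (- w) = - rdot v w.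
Proof. by rewrite rdotC rdotNl rdotC. Qed.

Lemma rdotBr u v w : rdot u (v - w) = rdot u v - rdot u w.
Proof. by rewrite rdotDr rdotNr. Qed.

Lemma rdot_il v w : rdot ('i%C *: v) w = - rdot v ('i%C *: w).
Proof.
rewrite /rdot -sumrN; apply: eq_bigr => j _; rewrite !mxE.
by case: (v 0 j) (w 0 j) => [a b] [a' b'] /=; ring.
Qed.

Lemma rdot_ii v w : rdot ('i%C *: v) ('i%C *: w) = rdot v w.
Proof.
apply: eq_bigr => j _; rewrite !mxE.
by case: (v 0 j) (w 0 j) => [a b] [a' b'] /=; ring.
Qed.

Lemma rdot_iC v : rdot ('i%C *: v) v = 0.
Proof.
have H : rdot ('i%C *: v) v = - rdot ('i%C *: v) v by rewrite {1}rdot_il rdotC.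
lra.
Qed.

Lemma scale_complex c v :
  c *: v = (complex.Re c)%:C *: v + (complex.Im c)%:C *: ('i%C *: v).
Proof. by rewrite {1}(complexE c) scalerDl scalerA mulrC. Qed.

Lemma rdotvv_ge0 v : 0 <= rdot v v.
Proof. by apply: sumr_ge0 => j _; rewrite addr_ge0 // -expr2 sqr_ge0. Qed.

Lemma enorm_ge0 v : 0 <= enorm v.
Proof. exact: sqrtr_ge0. Qed.

Lemma sqr_enorm v : enorm v ^+ 2 = rdot v v.
Proof. by rewrite sqr_sqrtr // rdotvv_ge0. Qed.

Lemma enormZ c v : enorm (c *: v) = cabs c * enorm v.
Proof.
have E : rdot (c *: v) (c *: v) = cabs c ^+ 2 * rdot v v :> R.
  rewrite scale_complex !(rdotDl, rdotDr, rdotZl, rdotZr) rdot_ii.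
  rewrite (rdotC v) rdot_iC !mulr0 addr0 add0r.
  case: c => a b /=; rewrite sqr_sqrtr ?addr_ge0 ?sqr_ge0 //; ring.
by rewrite /enorm E sqrtrM ?sqr_ge0 // sqrtr_sqr ger0_norm ?cabs_ge0.
Qed.

Lemma enormZr x v : enorm (x%:C *: v) = `|x| * enorm v.
Proof. by rewrite enormZ cabs_real. Qed.

Lemma enormN v : enorm (- v) = enorm v.
Proof. by rewrite /enorm rdotNl rdotNr opprK. Qed.

Lemma enormBC v w : enorm (v - w) = enorm (w - v).
Proof. by rewrite -enormN opprB. Qed.

Lemma rdot0l v : rdot 0 v = 0.
Proof. by rewrite -(scale0r v) (_ : 0 = 0%:C :> R[i]) // rdotZl mul0r. Qed.

Lemma enorm0 : enorm (0 : Cn) = 0.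
Proof. by rewrite /enorm rdot0l sqrtr0. Qed.

Lemma cabs_coord v j : cabs (v 0 j) <= enorm v.
Proof.
rewrite /enorm -[leLHS]ger0_norm ?cabs_ge0 // -sqrtr_sqr ler_sqrt ?rdotvv_ge0 //.
rewrite /rdot (bigD1 j) //= -[leLHS]addr0 lerD //; last first.
  by apply: sumr_ge0 => i _; rewrite addr_ge0 // -expr2 sqr_ge0.
by case: (v 0 j) => a b /=; rewrite sqr_sqrtr ?addr_ge0 ?sqr_ge0.
Qed.

Lemma enorm_eq0 v : enorm v = 0 -> v = 0.
Proof.
move=> v0; apply/rowP => j; rewrite mxE; apply: ComplexField.Normc.eq0_normc.
by apply/eqP; rewrite eq_le cabs_ge0 andbT -v0 cabs_coord.
Qed.

Lemma rdot_le v w : rdot v w <= enorm v * enorm w.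
Proof.
have [v0|v0] := eqVneq (enorm v) 0.
  by rewrite (enorm_eq0 v0) rdot0l enorm0 mul0r.
have [w0|w0] := eqVneq (enorm w) 0.
  by rewrite (enorm_eq0 w0) rdotC rdot0l enorm0 mulr0.
have v1 : 0 < enorm v by rewrite lt_neqAle eq_sym v0 enorm_ge0.
have w1 : 0 < enorm w by rewrite lt_neqAle eq_sym w0 enorm_ge0.
have := rdotvv_ge0 ((enorm w)%:C *: v - (enorm v)%:C *: w).
rewrite rdotBl !rdotBr !rdotZl !rdotZr -!sqr_enorm (rdotC w v) => H.
have vw : 0 < enorm v * enorm w by rewrite mulr_gt0.
rewrite -(ler_pM2l vw); lra.
Qed.

Lemma normr_rdot v w : `|rdot v w| <= enorm v * enorm w.
Proof.
rewrite ler_norml rdot_le andbT lerNl -rdotNl.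
by apply: le_trans (rdot_le _ _) _; rewrite enormN.
Qed.

Lemma enormD v w : enorm (v + w) <= enorm v + enorm w.
Proof.
rewrite -ler_sqr ?nnegrE ?addr_ge0 ?enorm_ge0 //.
rewrite sqrrD !sqr_enorm rdotDl !rdotDr (rdotC w v).
have := rdot_le v w; lra.
Qed.

Lemma enormB v w : enorm (v - w) <= enorm v + enorm w.
Proof. by rewrite (le_trans (enormD _ _)) // enormN. Qed.

Lemma enorm_dist_tri u v w : enorm (u - w) <= enorm (u - v) + enorm (v - w).
Proof. by rewrite -(subrKA v) enormD. Qed.

Lemma enorm_le_sum v : enorm v <= \sum_j cabs (v 0 j).
Proof.
rewrite {1}(row_sum_delta v); elim/big_ind2 : _ => [|x1 y1 x2 y2 h1 h2|j _].
- by rewrite enorm0.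
- by rewrite (le_trans (enormD _ _)) // lerD.
rewrite enormZ (_ : enorm _ = 1) ?mulr1 // /enorm /rdot (bigD1 j) //= big1.
  by rewrite !mxE !eqxx /= mulr1 mulr0 !addr0 sqrtr1.
by move=> i /negPf ij; rewrite !mxE eqxx ij /= !mulr0 addr0.
Qed.

(** Orthogonal projection for the Hermitian product, whose real part is rdot. The
    bounds 2 and 3 are not optimal: they come from estimating the real and
    imaginary parts of the coefficient separately. *)
Lemma hermitian_decomposition (N e : Cn) : enorm N = 1 ->
  exists a : R[i], exists v : Cn, [/\ e = a *: N + v, rdot v N = 0,
    rdot ('i%C *: v) N = 0, cabs a <= 2 * enorm e & enorm v <= 3 * enorm e].
Proof.
move=> N1; pose a := rdot e N +i* rdot e ('i%C *: N).
have aE : cabs a <= 2 * enorm e.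
  apply: le_trans (cabs_le_ReIm _) _; rewrite /=.
  have := normr_rdot e N; have := normr_rdot e ('i%C *: N).
  have -> : enorm ('i%C *: N) = 1 by rewrite enormZ N1 /= expr0n add0r expr1n sqrtr1 mulr1.
  by rewrite N1 mulr1; lra.
exists a, (e - a *: N); split => //; first by rewrite subrKC.
- rewrite rdotBl (scale_complex a) rdotDl !rdotZl rdot_iC mulr0 addr0 -sqr_enorm N1.
  by rewrite expr1n mulr1 subrr.
- rewrite rdot_il rdotBl (scale_complex a) rdotDl !rdotZl rdot_ii.
  rewrite (rdotC N) rdot_iC mulr0 add0r -sqr_enorm N1.
  by rewrite expr1n mulr1 subrr oppr0.
- apply: le_trans (enormB _ _) _; rewrite enormZ N1 mulr1; lra.
Qed.

Lemma norm_cabs c : `|c| = (cabs c)%:C.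
Proof. by rewrite normc_def; case: c. Qed.

(** The topology comes from the maximum norm; this is where it is compared with
    the Euclidean one. *)
Lemma nbhs_enormP (z : Cn) (A : set Cn) :
  nbhs z A <-> exists2 d : R, 0 < d & forall v, enorm (v - z) < d -> A v.
Proof.
split.
  move=> /nbhs_ballP[e /= e0 zeA].
  have [eI eR] : complex.Im e = 0 /\ 0 < complex.Re e.
    by move: e0; rewrite ltcE /= => /andP[/eqP <-].
  exists (complex.Re e) => // v vz; apply: zeA; split=> // i j; rewrite ord1.
  rewrite -ball_normE /=.
  have -> : e = (complex.Re e)%:C by case: e eI {e0 eR vz} => a b /= ->.
  rewrite -normrN opprB.
  rewrite norm_cabs ltcR.
  apply: le_lt_trans vz; have := cabs_coord (v - z) j; by rewrite !mxE.
move=> [d d0 dA]; apply/nbhs_ballP; pose m := d / (n.+1)%:R.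
have m0 : 0 < m by rewrite divr_gt0.
exists m%:C; first by rewrite /= ltcR.
move=> v [_ zv]; apply: dA; apply: le_lt_trans (enorm_le_sum _) _.
apply: (@le_lt_trans _ _ (\sum_(j < n) m)).
  apply: ler_sum => j _; have := zv 0 j; rewrite -ball_normE /=.
  by rewrite -normrN opprB norm_cabs ltcR !mxE => /ltW.
rewrite sumr_const card_ord -[_ *+ _]mulr_natr /m mulrAC ltr_pdivrMr //.
by rewrite ltr_pM2l // ltr_nat.
Qed.

Lemma mx_norm_le (v : Cn) : `|v| <= (enorm v)%:C.
Proof.
rewrite [`|v|](_ : _ = mx_norm v) //.
have [->|/mx_norm_neq0[[i j] ->]] := eqVneq (mx_norm v) 0.
  by rewrite lecR enorm_ge0.
by rewrite /= norm_cabs lecR ord1 cabs_coord.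
Qed.

Lemma continuous_enorm (f : Cn -> R) (z : Cn) : {for z, continuous f} ->
  forall e, 0 < e -> exists2 d : R, 0 < d & forall v, enorm (v - z) < d ->
    `|f v - f z| < e.
Proof.
move=> /cvgrPdist_lt fz e e0; have /nbhs_enormP[d d0 dP] := fz e e0.
by exists d => // v /dP /=; rewrite distrC.
Qed.

Lemma velocity_eps (g : R -> Cn) (t : R) (v : Cn) : is_velocity g t v ->
  forall e, 0 < e -> exists2 d : R, 0 < d & forall s, s \in `[0, 1] ->
    `|s - t| < d -> enorm (g s - g t - (s - t)%:C *: v) <= e * `|s - t|.
Proof.
move=> gv e e0.
have /gv : nbhs v [set u | enorm (u - v) < e] by apply/nbhs_enormP; exists e.
rewrite /nbhs /= /dnbhs => H.
have {H} : \forall s \near t, s != t -> s \in `[0, 1] ->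
    enorm (((s - t)^-1)%:C *: (g s - g t) - v) < e.
  exact: H.
move=> /nbhs_normP[d /= d0 dP]; exists d => // s s01 sd.
have [->|st] := eqVneq s t.
  by rewrite !subrr scale0r subr0 enorm0 normr0 mulr0.
have st0 : s - t != 0 by rewrite subr_eq0.
have sd' : `|t - s| < d by rewrite distrC.
have H := dP s sd' st s01.
have -> : g s - g t - (s - t)%:C *: v =
    (s - t)%:C *: (((s - t)^-1)%:C *: (g s - g t) - v).
  by rewrite scalerBr scalerA -rmorphM divff // scale1r.
by rewrite enormZr mulrC ler_wpM2r // ltW.
Qed.

(** Complex differentiability in terms of the Euclidean norm; A is linear in all
    uses. *)
Definition fderiv (f : Cn -> R[i]) (z : Cn) (A : Cn -> R[i]) :=
  forall e, 0 < e -> exists2 d : R, 0 < d & forall v, enorm v < d ->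
    cabs (f (z + v) - f z - A v) <= e * enorm v.

Lemma differentiable_fderiv (f : Cn -> R[i]) (z : Cn) :
  differentiable f z -> fderiv f z ('d f z).
Proof.
move=> df e e0.
have eC : 0 < e%:C by rewrite ltcR.
have := diff_locallyxC df; set o := the_littleo _ _ _ _ => oE.
have /nbhs_enormP[d d0 dP] := littleoP [littleo of o id] eC.
exists d => // v vd; have := dP v; rewrite subr0 => /(_ vd) ov.
rewrite oE (_ : _ - _ - _ = o id v); last by rewrite -addrA -opprD addrC addKr.
have : `|o id v| <= e%:C * (enorm v)%:C.
  by apply: le_trans ov _; rewrite ler_pM2l // mx_norm_le.
by rewrite norm_cabs -rmorphM lecR.
Qed.

Lemma fderiv_line (f : Cn -> R[i]) (z v : Cn) (A : {linear Cn -> R[i]}) c :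
  fderiv f (z + c *: v) A -> cderiv (fun s => f (z + s *: v)) c (A v).
Proof.
move=> fA e e0; have V0 : 0 < enorm v + 1 by rewrite ltr_wpDl ?enorm_ge0.
have [d d0 dP] := fA _ (divr_gt0 e0 V0).
exists (d / (enorm v + 1)) => [|h]; first by rewrite divr_gt0.
rewrite ltr_pdivlMr // => hd.
have h0 := cabs_ge0 h; have v0 := enorm_ge0 v.
have hv : enorm (h *: v) <= cabs h * (enorm v + 1).
  by rewrite enormZ ler_wpM2l // lerDl.
have := dP (h *: v) (le_lt_trans hv hd).
rewrite scalerDl addrA linearZ /= (mulrC (A v)) => H; apply: le_trans H _.
by rewrite mulrAC ler_pdivrMr // -mulrA ler_wpM2l // ltW.
Qed.

Lemma linear_bounded (A : {linear Cn -> R[i]}) :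
  exists2 B : R, 0 < B & forall v, cabs (A v) <= B * enorm v.
Proof.
pose B := 1 + \sum_j cabs (A (delta_mx 0 j)).
have B0 : 0 < B by rewrite ltr_pwDl // sumr_ge0 // => j _; exact: cabs_ge0.
exists B => // v; apply: (@le_trans _ _ (\sum_j enorm v * cabs (A (delta_mx 0 j)))).
  rewrite {1}(row_sum_delta v) linear_sum.
  elim/big_ind2 : _ => [|x1 y1 x2 y2 h1 h2|j _]; first by rewrite cabs0.
    by rewrite (le_trans (cabsD _ _)) // lerD.
  by rewrite linearZ cabsM ler_wpM2r ?cabs_ge0 ?cabs_coord.
rewrite -mulr_sumr mulrC ler_wpM2r ?enorm_ge0 // /B lerDr //.
Qed.
End EuclideanTheory.

(** * First-order expansion of C^1 functions *)

Lemma tilt_error (R : realType) (a b s t D D' E F : R) :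
  `|b - a - D' * (s - t)| <= E * `|s - t| -> `|D' - D| <= F ->
  `|b - s * D - (a - t * D)| <= (F + E) * `|s - t|.
Proof.
move=> h1 h2.
have -> : b - s * D - (a - t * D) = (b - a - D' * (s - t)) + (D' - D) * (s - t).
  by ring.
apply: le_trans (ler_normD _ _) _; rewrite normrM.
have := normr_ge0 (s - t); nra.
Qed.

Lemma three_step_error (R : realType) (r0 r1 r2 r3 a b c A B C : R) :
  `|r1 - r0 - a| <= A -> `|r2 - r1 - b| <= B -> `|r3 - r2 - c| <= C ->
  `|r3 - r0 - (a + b + c)| <= A + B + C.
Proof.
move=> h1 h2 h3.
have -> : r3 - r0 - (a + b + c) = (r1 - r0 - a) + (r2 - r1 - b) + (r3 - r2 - c).
  by ring.
apply: le_trans (ler_normD _ _) (lerD _ h3).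
exact: le_trans (ler_normD _ _) (lerD h1 h2).
Qed.

Section C1Expansion.
Variables (R : realType) (n : nat).
Local Notation Cn := 'rV[R[i]]_n.

(** The base point z varies near p while the slope is taken at p: the mean value
    inequality is applied to s |-> rho (z + s v) minus its slope at p, and the
    partial derivative is close to its value at p by continuity. *)
Lemma partial_expansion (W : set Cn) (rho : Cn -> R) (p v : Cn) :
  open W -> W p -> enorm v <= 1 -> has_continuous_partial W rho v ->
  forall e, 0 < e -> exists2 d : R, 0 < d & forall z (x : R),
    enorm (z - p) < d -> `|x| < d ->
    `|rho (z + x%:C *: v) - rho z - x * dirder rho v p| <= e * `|x|.
Proof.
move=> oW Wp v1 pW e e0.
have [d1 d10 P1] := (nbhs_enormP p W).1 (open_nbhs_nbhs (conj oW Wp)).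
have [d2 d20 P2] := continuous_enorm (pW p Wp).2 e0.
pose d := Num.min d1 d2; have d0 : 0 < d by rewrite lt_min d10.
exists (d / 2) => [|z x zp xd]; first by rewrite divr_gt0.
pose psi s := rho (z + s%:C *: v) - s * dirder rho v p.
have zt t : `|t| <= `|x| -> enorm (z + t%:C *: v - p) < d.
  move=> tx; rewrite addrAC; apply: le_lt_trans (enormD _ _) _.
  by rewrite enormZr; have := normr_ge0 t; have := enorm_ge0 v; nra.
have loc t : `|t| <= `|x| -> forall e', 0 < e' -> exists2 dl : R, 0 < dl &
    forall s, `|s - t| < dl -> `|psi s - psi t| <= (e + e') * `|s - t|.
  move=> tx e' e'0; have := zt t tx; rewrite lt_min => /andP[z1 z2].
  have Wz := P1 _ z1; have Dz := P2 _ z2.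
  have [dl dl0 dlP] := derivable_eps (pW _ Wz).1 e'0.
  exists dl => // s sd.
  have H : `|rho (z + s%:C *: v) - rho (z + t%:C *: v) -
      dirder rho v (z + t%:C *: v) * (s - t)| <= e' * `|s - t|.
    have al0 : along rho (z + t%:C *: v) v 0 = rho (z + t%:C *: v).
      by rewrite /along scale0r addr0.
    have -> : z + s%:C *: v = z + t%:C *: v + (s - t)%:C *: v.
      by rewrite -addrA -scalerDl -rmorphD subrKC.
    by have := dlP _ sd; rewrite add0r al0.
  exact: (tilt_error H (ltW Dz)).
have -> : rho (z + x%:C *: v) - rho z - x * dirder rho v p = psi x - psi 0.
  by rewrite /psi scale0r addr0 mul0r subr0 addrAC.
pose D s t := `|psi s - psi t|.
have Ds s t : D s t = D t s by rewrite /D distrC.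
have Dt s t u : D s u <= D s t + D t u by rewrite /D ler_distD.
have [x0|x0] := leP 0 x.
  rewrite -[`|_ - _|]/(D x 0) Ds (ger0_norm x0) -[X in e * X]subr0.
  apply: mean_value_le => // t /andP[t0 tx] e' e'0.
  have [|dl dl0 dlP] := loc t _ e' e'0; first by rewrite !ger0_norm.
  by exists dl => // s _; exact: dlP.
rewrite -[`|_ - _|]/(D x 0) (ltr0_norm x0) -[X in e * X]sub0r.
apply: mean_value_le => //; first exact: ltW.
move=> t /andP[tx t0] e' e'0.
have [|dl dl0 dlP] := loc t _ e' e'0.
  by rewrite !ler0_norm ?(ltW x0) // lerN2.
by exists dl => // s _; exact: dlP.
Qed.

Lemma enorm_ex (j : 'I_n) : enorm (ex R j) <= 1.
Proof.
apply: le_trans (enorm_le_sum _) _; rewrite (bigD1 j) //= big1 => [|i /negPf ij].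
  by rewrite /ex mxE !eqxx addr0 ComplexField.Normc.normc1.
by rewrite /ex mxE ij andbF cabs0.
Qed.

Lemma enorm_ey (j : 'I_n) : enorm (ey R j) <= 1.
Proof.
by rewrite /ey enormZ /= expr0n add0r expr1n sqrtr1 mul1r enorm_ex.
Qed.

(** Continuous partial derivatives give differentiability: u is added one complex
    coordinate at a time, its real part first, and the increments are expanded
    along the way. *)
Lemma C1_expansion (W : set Cn) (rho : Cn -> R) (p : Cn) :
  open W -> W p -> C1_on W rho ->
  forall e, 0 < e -> exists2 d : R, 0 < d & forall u, enorm u < d ->
    `|rho (p + u) - rho p - rdot u (grad rho p)| <= e * enorm u.
Proof.
move=> oW Wp C1.
pose step (u : Cn) (j : 'I_n) : Cn := u 0 j *: delta_mx 0 j.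
pose lin (u : Cn) (j : 'I_n) := complex.Re (u 0 j) * dirder rho (ex R j) p +
   complex.Im (u 0 j) * dirder rho (ey R j) p.
have stepE u j : step u j = (complex.Re (u 0 j))%:C *: ex R j +
   (complex.Im (u 0 j))%:C *: ey R j by rewrite /step scale_complex.
have main (s : seq 'I_n) e : 0 < e -> exists2 d : R, 0 < d & forall z u,
    enorm (z - p) < d -> enorm u < d ->
    `|rho (z + \sum_(j <- s) step u j) - rho z - \sum_(j <- s) lin u j|
       <= e * enorm u.
  elim: s e => [|j s IH] e e0.
    exists 1 => // z u _ _; rewrite !big_nil addr0 subrr subr0 normr0.
    by rewrite mulr_ge0 ?enorm_ge0 // ltW.
  have e3 : 0 < e / 3 by rewrite divr_gt0.
  have [d1 d10 P1] := IH _ e3.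
  have [Cx Cy] := C1 j.
  have [d2 d20 P2] := partial_expansion oW Wp (enorm_ex j) Cx e3.
  have [d3 d30 P3] := partial_expansion oW Wp (enorm_ey j) Cy e3.
  pose d := Num.min d1 (Num.min d2 d3).
  have d0 : 0 < d by rewrite !lt_min d10 d20.
  exists (d / 3) => [|z u zp ud]; first by rewrite divr_gt0.
  have [dd1 dd2 dd3] : [/\ d <= d1, d <= d2 & d <= d3].
    by rewrite !ge_min !lexx !orbT.
  have ux := le_trans (normr_Re _) (cabs_coord u j).
  have uy := le_trans (normr_Im _) (cabs_coord u j).
  rewrite !big_cons stepE.
  have thirds (r : R) : e / 3 * r + e / 3 * r + e / 3 * r <= e * r by lra.
  have lt1 (a : R) : a < d / 3 -> a < d by move: d0; lra.
  have lt2 (a b c : R) : a < d / 3 -> b < d / 3 -> c <= a + b -> c < d by lra.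
  have lt3 (a b c : R) : a < d / 3 -> b < d / 3 -> c <= a + b + b -> c < d by lra.
  move: ux uy; rewrite /lin.
  move: (complex.Re (u 0 j)) (complex.Im (u 0 j)) => x y ux uy.
  have x1 : enorm (x%:C *: ex R j) <= enorm u.
    by rewrite enormZr (le_trans _ ux) // ler_piMr // enorm_ex.
  have y1 : enorm (y%:C *: ey R j) <= enorm u.
    by rewrite enormZr (le_trans _ uy) // ler_piMr // enorm_ey.
  have e1 := P2 z x (lt_le_trans (lt1 _ zp) dd2)
    (lt_le_trans (lt1 _ (le_lt_trans ux ud)) dd2).
  rewrite !addrA; pose z1 := z + x%:C *: ex R j.
  have hz1 : enorm (z1 - p) <= enorm (z - p) + enorm u.
    rewrite /z1 (addrAC z); apply: le_trans (enormD _ _) _.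
    exact: (lerD (lexx _) x1).
  have e2 := P3 z1 y (lt_le_trans (lt2 _ _ _ zp ud hz1) dd3)
    (lt_le_trans (lt1 _ (le_lt_trans uy ud)) dd3).
  pose z2 := z1 + y%:C *: ey R j.
  have hz2 : enorm (z2 - p) <= enorm (z - p) + enorm u + enorm u.
    rewrite /z2 (addrAC z1); apply: le_trans (enormD _ _) _.
    exact: (lerD hz1 y1).
  have e4 := P1 z2 u (lt_le_trans (lt3 _ _ _ zp ud hz2) dd1)
    (lt_le_trans (lt1 _ ud) dd1).
  apply: le_trans (three_step_error e1 e2 e4) _.
  have E1 : e / 3 * `|x| <= e / 3 * enorm u by rewrite ler_wpM2l // ltW.
  have E2 : e / 3 * `|y| <= e / 3 * enorm u by rewrite ler_wpM2l // ltW.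
  apply: le_trans (lerD (lerD E1 E2) (lexx _)) _.
  exact: thirds.
move=> e e0; have [d d0 P] := main (index_enum 'I_n) e e0.
exists d => // u ud; have := P p u _ ud; rewrite subrr enorm0 => /(_ d0).
rewrite /step -row_sum_delta.
by congr (`|_ - _| <= _); apply: eq_bigr => j _; rewrite /lin /grad mxE.
Qed.

End C1Expansion.

(** * Nearest boundary points and normals *)

Section NearestPoint.
Variables (R : realType) (n : nat) (Omega : set 'rV[R[i]]_n).
Local Notation Cn := 'rV[R[i]]_n.

Definition nearest (q p : Cn) := [/\ Omega q, bd Omega p &
  forall p', bd Omega p' -> enorm (q - p) <= enorm (q - p')].

Hypothesis oOmega : open Omega.

Lemma bd_not (p : Cn) : bd Omega p -> ~ Omega p.
Proof. by move=> [_ nint] Op; apply: nint; exact: open_nbhs_nbhs. Qed.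

Lemma nearest_gt0 q p : nearest q p -> 0 < enorm (q - p).
Proof.
move=> [Oq bp _]; rewrite lt_neqAle enorm_ge0 andbT eq_sym; apply/eqP.
by move=> /enorm_eq0 /eqP; rewrite subr_eq0 => /eqP qp; apply: (bd_not bp); rewrite -qp.
Qed.

(** A segment from q that stays closer to q than the boundary does cannot leave
    Omega: being in Omega is locally constant off the boundary. *)
Lemma nearest_ball q p z :
  nearest q p -> enorm (z - q) < enorm (q - p) -> Omega z.
Proof.
move=> [Oq bp qmin] zq.
have [c [c0 c1 lip cq]] : exists c : R -> Cn, [/\ c 0 = q, c 1 = z,
    forall s t, enorm (c s - c t) = `|s - t| * enorm (z - q) &
    forall t, 0 <= t -> t <= 1 -> enorm (q - c t) <= enorm (z - q)].
  exists (fun t => q + t%:C *: (z - q)); split.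
  - by rewrite scale0r addr0.
  - by rewrite scale1r subrKC.
  - by move=> s t; rewrite opprD addrACA subrr add0r -scalerBl -rmorphB enormZr.
  - move=> t t0 t1; rewrite opprD addNKr enormN enormZr ger0_norm //.
    by rewrite ler_piMl ?enorm_ge0.
suff : Omega (c 0) -> Omega (c 1) by rewrite c0 c1; exact.
have Z0 : 0 < enorm (z - q) + 1 by rewrite ltr_wpDl ?enorm_ge0.
apply: (@local_to_interval R (fun s t => Omega (c s) -> Omega (c t)) 0 1 ler01).
  by move=> x y t _ _ _ _ h1 h2 h; exact: (h2 (h1 h)).
move=> t /andP[t0 t1].
have [d d0 dP] : exists2 d : R, 0 < d &
   (forall w, enorm (w - c t) < d -> Omega w) \/
   (forall w, enorm (w - c t) < d -> ~ Omega w).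
  have [Oc|nOc] := pselect (Omega (c t)).
    have [d d0 dP] := (nbhs_enormP (c t) Omega).1 (open_nbhs_nbhs (conj oOmega Oc)).
    by exists d; [exact: d0|left; exact: dP].
  have nb : ~ bd Omega (c t).
    move=> /qmin; apply/negP; rewrite -ltNge.
    exact: le_lt_trans (cq t t0 t1) zq.
  have : ~ closure Omega (c t).
    move=> cl; apply: nb; split => // /interior_subset; exact: nOc.
  move=> /existsNP[B /not_implyP[/nbhs_enormP[d d0 dP] nB]].
  exists d; first exact: d0.
  right => w wd Ow; apply: nB; exists w; split; [exact: Ow|exact: dP wd].
exists (d / (enorm (z - q) + 1)); first by rewrite divr_gt0.
move=> x y _ xt ty _.
rewrite ltr_pdivlMr // => xyd.
have E := enorm_ge0 (z - q).
have cx : enorm (c x - c t) < d by rewrite lip distrC ger0_norm ?subr_ge0 //; nra.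
have cy : enorm (c y - c t) < d by rewrite lip ger0_norm ?subr_ge0 //; nra.
by case: dP => dP Ox; [exact: dP cy|case: (dP _ cx Ox)].
Qed.

(** A vector v with positive product with q - p points from p into the ball of
    the previous lemma, where rho is negative while rho p >= 0; so the product
    of v with grad rho p is at most 0. A gradient with this property for all
    such v is a negative multiple of q - p. *)
Lemma nearest_grad q p W rho : nearest q p -> defining_near Omega p W rho ->
  exists2 c : R, 0 < c & grad rho p = c%:C *: (p - q).
Proof.
move=> qp [oW Wp C1 OW gn0]; have [Oq bp qmin] := qp.
have rp : 0 <= rho p.
  rewrite leNgt; apply/negP => rp.
  have : ([set z | rho z < 0] `&` W) p by [].
  by rewrite -OW => -[/(bd_not bp)].
set g := grad rho p; have [a aE] : exists a, a = q - p by exists (q - p).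
have a0 : 0 < rdot a a by rewrite -sqr_enorm aE exprn_gt0 // nearest_gt0.
have half v : 0 < rdot v a -> rdot v g <= 0.
  move=> va; rewrite leNgt; apply/negP => vg.
  have V0 : 0 < enorm v.
    rewrite lt_neqAle enorm_ge0 andbT eq_sym; apply/eqP => /enorm_eq0 v0.
    by move: va; rewrite v0 rdot0l ltxx.
  have [d1 d10 P1] := C1_expansion oW Wp C1 (divr_gt0 (divr_gt0 vg V0) (ltr0n R 2)).
  have [d2 d20 P2] := (nbhs_enormP p W).1 (open_nbhs_nbhs (conj oW Wp)).
  (* The first bound keeps p + h v where rho is controlled, the second keeps it
     in the ball around q. *)
  pose h := Num.min (Num.min d1 d2 / (enorm v + 1)) (rdot v a / rdot v v).
  have vv : 0 < rdot v v by rewrite -sqr_enorm exprn_gt0.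
  have V1 : 0 < enorm v + 1 by lra.
  have h0 : 0 < h by rewrite !(lt_min, divr_gt0) ?d10.
  have hd : h * enorm v < Num.min d1 d2.
    have : h <= Num.min d1 d2 / (enorm v + 1) by rewrite ge_min lexx.
    rewrite ler_pdivlMr // => H; lra.
  have hva : h * rdot v v <= rdot v a.
    have : h <= rdot v a / rdot v v by rewrite ge_min lexx orbT.
    by rewrite ler_pdivlMr.
  have en : enorm (h%:C *: v) = h * enorm v by rewrite enormZr gtr0_norm.
  move: hd; rewrite lt_min -en => /andP[hd1 hd2].
  have Oz : Omega (p + h%:C *: v).
    apply: (nearest_ball qp); rewrite -ltr_sqr ?nnegrE ?enorm_ge0 // !sqr_enorm.
    have -> : p + h%:C *: v - q = h%:C *: v - a by rewrite aE opprB addrA (addrC p).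
    rewrite -aE !(rdotBl, rdotBr, rdotZl, rdotZr) (rdotC a v); nra.
  have Wz : W (p + h%:C *: v) by apply: P2; rewrite addrC addKr.
  have : (Omega `&` W) (p + h%:C *: v) by [].
  rewrite OW => -[/= rz _].
  have := P1 _ hd1; rewrite ler_distl en rdotZl => /andP[H _].
  have : rdot v g / enorm v / 2 * (h * enorm v) = h * (rdot v g / 2).
    by field; rewrite gt_eqF.
  move: H; rewrite -/g; have : 0 < h * rdot v g by rewrite mulr_gt0.
  lra.
have ag : rdot a g <= 0 by exact: half.
pose k := rdot g a / rdot a a.
have [b bE] : exists b, b = g - k%:C *: a by exists (g - k%:C *: a).
have ba : rdot b a = 0 by rewrite bE rdotBl rdotZl /k divfK ?subrr // gt_eqF.
have bg : rdot b g = rdot b b.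
  by rewrite {3}bE rdotBr rdotZr ba mulr0 subr0.
(* Test directions s a + b with s -> 0+: the part b of g orthogonal to a
   vanishes. *)
have b0 : b = 0.
  apply: enorm_eq0; apply/eqP; rewrite -sqrf_eq0 sqr_enorm eq_le rdotvv_ge0 andbT.
  apply/ler_addgt0Pr => e e0; rewrite add0r.
  pose s := e / (1 - rdot a g).
  have s0 : 0 < s by rewrite divr_gt0 //; lra.
  have := half (s%:C *: a + b); rewrite !rdotDl !rdotZl ba addr0 mulr_gt0 // bg.
  move=> /(_ isT); have : s * (1 - rdot a g) = e by rewrite divfK // gt_eqF //; lra.
  lra.
have gk : g = k%:C *: a by apply/eqP; rewrite -subr_eq0 -bE b0.
exists (- k); last by rewrite gk aE rmorphN scaleNr -scalerN opprB.
have k0 : k <= 0 by rewrite /k (rdotC g) pmulr_lle0 // invr_gt0.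
rewrite oppr_gt0 lt_neqAle k0 andbT; apply: contra (gn0 _ bp Wp) => /eqP k00.
by rewrite -/g gk k00 scale0r.
Qed.

(** By [unit_normal_grad] this is the outward normal at p; the formula avoids
    choosing a defining function. *)
Definition unit_normal (q p : Cn) : Cn := ((enorm (q - p))^-1)%:C *: (p - q).

Lemma enorm_unit_normal q p : nearest q p -> enorm (unit_normal q p) = 1.
Proof.
move=> /nearest_gt0 d0; rewrite /unit_normal enormZr gtr0_norm ?invr_gt0 //.
by rewrite (enormBC p) mulVf // gt_eqF.
Qed.

Lemma unit_normalE q p : nearest q p ->
  q = p - (enorm (q - p))%:C *: unit_normal q p.
Proof.
move=> /nearest_gt0 d0; rewrite /unit_normal scalerA -rmorphM divff ?gt_eqF //.
by rewrite scale1r opprB subrKC.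
Qed.

Lemma unit_normal_grad q p W rho : nearest q p -> defining_near Omega p W rho ->
  unit_normal q p = ((enorm (grad rho p))^-1)%:C *: grad rho p.
Proof.
move=> qp /(nearest_grad qp)[c c0 ->]; have d0 := nearest_gt0 qp.
rewrite enormZr gtr0_norm // scalerA -rmorphM /unit_normal (enormBC p).
by congr (_%:C *: _); rewrite invfM mulrAC mulVf ?mul1r // gt_eqF.
Qed.

Lemma nearest_outward_normal q p : C1_boundary Omega -> nearest q p ->
  outward_normal Omega p (unit_normal q p).
Proof.
move=> C1 qp; have [_ /C1[W [rho D]] _] := qp.
by exists W, rho; split; [exact: D|exact: unit_normal_grad qp D].
Qed.

(** One defining function with rdot v (grad rho p) = 0 is asked for, but all their
    gradients are parallel to the normal. *)
Lemma real_tangentP q p v : C1_boundary Omega -> nearest q p ->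
  real_tangent Omega p v <-> rdot v (unit_normal q p) = 0.
Proof.
move=> C1 qp; have d0 := nearest_gt0 qp; split.
  move=> [W [rho [D]]]; have [c c0 ->] := nearest_grad qp D.
  rewrite /unit_normal !rdotZr => /eqP; rewrite mulf_eq0 gt_eqF //= => /eqP ->.
  by rewrite mulr0.
rewrite /unit_normal rdotZr => /eqP; rewrite mulf_eq0 invr_eq0 gt_eqF //= => /eqP vpq.
have [_ /C1[W [rho D]] _] := qp; exists W, rho; split; first exact: D.
by have [c c0 ->] := nearest_grad qp D; rewrite rdotZr vpq mulr0.
Qed.

Lemma complex_tangentP q p v : C1_boundary Omega -> nearest q p ->
  complex_tangent Omega p v <->
  rdot v (unit_normal q p) = 0 /\ rdot ('i%C *: v) (unit_normal q p) = 0.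
Proof.
move=> C1 qp; rewrite /complex_tangent.
by split => -[/(real_tangentP _ C1 qp) ? /(real_tangentP _ C1 qp) ?].
Qed.

Lemma normalize_dist (a b : Cn) : a != 0 -> b != 0 ->
  enorm ((enorm a)^-1%:C *: a - (enorm b)^-1%:C *: b) <= 2 * enorm (a - b) / enorm b.
Proof.
have pos (c : Cn) : c != 0 -> 0 < enorm c.
  move=> c0; rewrite lt_neqAle enorm_ge0 andbT eq_sym; apply: contra c0 => /eqP /enorm_eq0 ->.
  exact: eqxx.
move=> /pos a0 /pos b0.
have -> : (enorm a)^-1%:C *: a - (enorm b)^-1%:C *: b =
   (enorm b)^-1%:C *: (a - b) + ((enorm a)^-1 - (enorm b)^-1)%:C *: a.
  by rewrite scalerBr rmorphB scalerBl [RHS]addrC subrKA.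
apply: le_trans (enormD _ _) _; rewrite !enormZr gtr0_norm ?invr_gt0 //.
have E : `|(enorm a)^-1 - (enorm b)^-1| * enorm a = `|enorm b - enorm a| / enorm b.
  rewrite -[X in _ * X](gtr0_norm a0) -[X in _ / X](gtr0_norm b0) -normrM -normf_div.
  by congr `|_|; field; rewrite !gt_eqF.
rewrite E.
have : `|enorm b - enorm a| <= enorm (a - b).
  rewrite ler_distl; have := enorm_dist_tri a b 0; have := enorm_dist_tri b a 0.
  rewrite !subr0 (enormBC b a); lra.
rewrite -(ler_pM2r (_ : 0 < (enorm b)^-1)) ?invr_gt0 //; lra.
Qed.

Lemma row_complexB (a b c d : 'I_n -> R) j :
  ((\row_j (a j +i* b j) - \row_j (c j +i* d j)) : Cn) 0 j =
  (a j - c j) +i* (b j - d j).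
Proof. by rewrite !mxE. Qed.

Lemma grad_continuous (W : set Cn) rho x : open W -> W x -> C1_on W rho ->
  forall e, 0 < e -> exists2 d : R, 0 < d & forall y, enorm (y - x) < d ->
    W y /\ enorm (grad rho y - grad rho x) <= e.
Proof.
move=> oW Wx C1 e e0; pose e' := e / (2 * n.+1%:R).
have e'0 : 0 < e' by rewrite divr_gt0 // mulr_gt0.
have NW : nbhs x W by exact: open_nbhs_nbhs.
have NG : nbhs x [set y | forall j : 'I_n,
    `|dirder rho (ex R j) x - dirder rho (ex R j) y| <= e' /\
    `|dirder rho (ey R j) x - dirder rho (ey R j) y| <= e'].
  apply: (@filter_forall Cn 'I_n (fun j y =>
    `|dirder rho (ex R j) x - dirder rho (ex R j) y| <= e' /\
    `|dirder rho (ey R j) x - dirder rho (ey R j) y| <= e') (nbhs x) _) => j.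
  have [/(_ _ Wx)[_ cx] /(_ _ Wx)[_ cy]] := C1 j.
  apply: filterI; first by move/cvgrPdist_le: cx; apply.
  by move/cvgrPdist_le: cy; apply.
have [d d0 dP] := (nbhs_enormP x _).1 (filterI NW NG).
 exists d => // y /dP[Wy H]; split => //.
apply: le_trans (enorm_le_sum _) _.
apply: (@le_trans _ _ (\sum_(j < n) (2 * e'))).
  apply: ler_sum => j _; have [hx hy] := H j.
  apply: le_trans (cabs_le_ReIm _) _; rewrite row_complexB mulr_natl mulr2n.
  by apply: lerD; rewrite distrC; [exact: hx|exact: hy].
rewrite sumr_const card_ord -[_ *+ _]mulr_natr /e'.
have n0 : 0 < n.+1%:R :> R by [].
rewrite [leLHS](_ : _ = e * (n%:R / n.+1%:R)); last by field; rewrite ?natr1 ?nat1r pnatr_eq0.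
by rewrite ler_piMr ?(ltW e0) // ler_pdivrMr // mul1r ler_nat.
Qed.

(** Near a point of the closure of U a single defining function computes all the
    normals, and its normalized gradient is continuous; compactness makes the
    radius uniform. *)
Lemma unit_normal_unif_cont (U : set Cn) : C1_boundary Omega ->
  U `<=` bd Omega -> compact (closure U) ->
  forall e, 0 < e -> exists2 d : R, 0 < d & forall q q' p p',
    U p -> U p' -> nearest q p -> nearest q' p' -> enorm (p - p') < d ->
    enorm (unit_normal q p - unit_normal q' p') <= e.
Proof.
move=> C1 Ubd cU e e0.
have clU : closure U `<=` bd Omega.
  move=> x xU; split => [B /nbhs_interior /xU[u [Uu Bu]]|xint].
    by have [cu _] := Ubd u Uu; exact: cu.
  by have [u [Uu Ou]] := xU _ xint; exact: (bd_not (Ubd u Uu)).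
have near_cov := (compact_near_coveringP _).1 cU.
have : \forall d \near (0 : R)^'+, closure U `<=` [set p | forall p' q q',
    bd Omega p -> bd Omega p' -> nearest q p -> nearest q' p' ->
    enorm (p - p') < d -> enorm (unit_normal q p - unit_normal q' p') <= e].
  apply: near_cov => x /clU bx.
  have [W [rho D]] := C1 x bx; have [oW Wx C1W OW gn0] := D.
  have G0 : 0 < enorm (grad rho x).
    rewrite lt_neqAle enorm_ge0 andbT eq_sym.
    by apply: contra (gn0 x bx Wx) => /eqP /enorm_eq0 ->.
  have [d d0 dP] := grad_continuous oW Wx C1W
    (mulr_gt0 (divr_gt0 e0 (ltr0n R 4)) G0).
  have dd : d / 2 < d by rewrite ltr_pdivrMr // ltr_pMr // ltr1n.
  have normal_near y z : bd Omega y -> nearest z y -> enorm (y - x) < d ->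
      enorm (unit_normal z y - ((enorm (grad rho x))^-1)%:C *: grad rho x) <= e / 2.
    move=> by_ zy /dP[Wy gy].
    have Dy : defining_near Omega y W rho by [].
    rewrite (unit_normal_grad zy Dy).
    apply: le_trans (normalize_dist (gn0 _ by_ Wy) (gn0 _ bx Wx)) _.
    rewrite ler_pdivrMr //; move: gy G0.
    by move: (enorm (grad rho x)) (enorm _) => r1 r2; lra.
  exists ([set p | enorm (p - x) < d / 2], [set d' | d' < d / 2]).
    split => /=; last by apply: nbhs_right_lt; rewrite divr_gt0.
    by apply/nbhs_enormP; exists (d / 2); rewrite ?divr_gt0.
  move=> [y d'] /= [yx d'd] p' q q' by_ bp' qy qp' yp'.
  have h1 := normal_near y q by_ qy (lt_trans yx dd).
  have p'x : enorm (p' - x) < d.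
    apply: le_lt_trans (enorm_dist_tri _ y _) _; rewrite (enormBC p').
    by rewrite [d]splitr ltrD // (lt_trans yp').
  have h2 := normal_near p' q' bp' qp' p'x.
  apply: le_trans (enorm_dist_tri _ _ _) _.
  rewrite [e]splitr; apply: (lerD h1); rewrite enormBC; exact: h2.
move=> H; have [d [d0 dP]] : exists d : R, 0 < d /\ closure U `<=`
  [set p | forall p' q q',
    bd Omega p -> bd Omega p' -> nearest q p -> nearest q' p' ->
    enorm (p - p') < d -> enorm (unit_normal q p - unit_normal q' p') <= e].
  have HI := @filterI _ _ _ _ _ (nbhs_right_gt (0 : R)) H.
  by have [d [dpos dP]] := @filter_ex _ _ _ _ (HI _); exists d.
exists d; first exact: d0.
move=> q q' p p' Up Up' qp qp' pp'.
apply: (dP p (subset_closure Up) p' q q') => //; exact: Ubd.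
Qed.

End NearestPoint.

(** * Variation along curves *)

Lemma cderiv_sub (R : realType) (f g : R[i] -> R[i]) w c d :
  cderiv f w c -> cderiv g w d -> cderiv (fun z => f z - g z) w (c - d).
Proof.
move=> df dg e e0; have e2 : 0 < e / 2 by rewrite divr_gt0.
have [d1 d10 P1] := df _ e2; have [d2 d20 P2] := dg _ e2.
exists (Num.min d1 d2); first by rewrite lt_min d10.
move=> h; rewrite lt_min => /andP[/P1 H1 /P2 H2].
have -> : f (w + h) - g (w + h) - (f w - g w) - (c - d) * h =
  (f (w + h) - f w - c * h) - (g (w + h) - g w - d * h) by ring.
apply: le_trans (cabsB _ _) _; apply: le_trans (lerD H1 H2) _; lra.
Qed.

Section CurveEstimates.
Variables (R : realType) (n : nat).
Local Notation Cn := 'rV[R[i]]_n.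

(** r1 and r2 are the sizes of the remainder and of the increment of a curve with
    velocity of norm V over a time h; B bounds the differential of f. *)
Lemma curve_increment_error (e B V h r1 r2 : R) : 0 < e -> 0 < B -> 0 <= V ->
  0 <= h -> r1 <= Num.min 1 (e / 2 / B) * h -> r2 <= r1 + h * V ->
  e / 2 / (V + 1) * r2 + B * r1 <= e * h.
Proof.
move=> e0 B0 V0 h0 h1 h2; have V1 : 0 < V + 1 by lra.
have r1h : r1 <= h.
  by apply: le_trans h1 _; rewrite ler_piMl // ge_min lexx.
have r1e : B * r1 <= e / 2 * h.
  rewrite mulrC -ler_pdivlMr // mulrAC; apply: le_trans h1 _.
  by rewrite ler_wpM2r // ge_min lexx orbT.
have : e / 2 / (V + 1) * r2 <= e / 2 * h.
  rewrite mulrAC ler_pdivrMr // -[leRHS]mulrA ler_pM2l ?divr_gt0 //; lra.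
lra.
Qed.

(** Mean value inequality for f along the translated curve g - u, whose velocity
    is that of g. *)
Lemma curve_variation (f : Cn -> R[i]) (g g1 : R -> Cn) (u : Cn) (a b M : R) :
  a <= b -> 0 <= a -> b <= 1 ->
  (forall t, a <= t <= b -> is_velocity g t (g1 t)) ->
  (forall t, a <= t <= b -> differentiable f (g t - u) /\
     cabs ('d f (g t - u) (g1 t)) <= M) ->
  cabs (f (g a - u) - f (g b - u)) <= M * (b - a).
Proof.
move=> ab a0 b1 gv fM.
apply: (@mean_value_le R (fun s t => cabs (f (g s - u) - f (g t - u)))) => //.
- by move=> s t; exact: cabsBC.
- move=> s t r; rewrite -(subrKA (f (g t - u))); exact: cabsD.
move=> t tab e e0; have [df dM] := fM t tab.
have [B B0 BP] := linear_bounded ('d f (g t - u)).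
have V0 := enorm_ge0 (g1 t).
have m0 : 0 < Num.min 1 (e / 2 / B) by rewrite lt_min ltr01 !divr_gt0.
have V1 : 0 < enorm (g1 t) + 1 by rewrite ltr_wpDl.
have e2 : 0 < e / 2 / (enorm (g1 t) + 1) by rewrite !divr_gt0.
have [d1 d10 P1] := velocity_eps (gv t tab) m0.
have [d2 d20 P2] := differentiable_fderiv df e2.
exists (Num.min d1 (d2 / (enorm (g1 t) + 1))).
  by rewrite lt_min d10 divr_gt0.
move=> s sab; rewrite lt_min ltr_pdivlMr // => /andP[sd1 sd2].
have s01 : s \in `[0, 1].
  have /andP[as_ sb] := sab.
  by rewrite in_itv /= (le_trans a0 as_) (le_trans sb b1).
have H1 := P1 s s01 sd1.
set h := s - t in sd1 sd2 H1 *.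
have vE : g s - g t = (g s - g t - h%:C *: g1 t) + h%:C *: g1 t by rewrite subrK.
have H2 : enorm (g s - g t) <=
    enorm (g s - g t - h%:C *: g1 t) + `|h| * enorm (g1 t).
  by rewrite {1}vE -enormZr; exact: enormD.
have H3 : enorm (g s - g t) < d2.
  apply: le_lt_trans (le_trans H2 _) sd2; rewrite mulrDr mulr1 addrC lerD2l.
  by apply: le_trans H1 _; rewrite ler_piMl // ge_min lexx.
have H4 := P2 _ H3.
have gsu : g t - u + (g s - g t) = g s - u by rewrite addrC subrKA.
rewrite gsu in H4.
have AE : 'd f (g t - u) (g s - g t) =
    'd f (g t - u) (g s - g t - h%:C *: g1 t) + h%:C * 'd f (g t - u) (g1 t).
  rewrite [in LHS]vE linearD; congr (_ + _); exact: linearZ.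
have split_sum (x y z : R[i]) : x = x - (y + z) + y + z by ring.
have -> : f (g s - u) - f (g t - u) =
  (f (g s - u) - f (g t - u) - 'd f (g t - u) (g s - g t)) +
  'd f (g t - u) (g s - g t - h%:C *: g1 t) + h%:C * 'd f (g t - u) (g1 t).
  by rewrite AE; exact: split_sum.
apply: le_trans (cabsD _ _) _.
apply: le_trans (lerD (cabsD _ _) (lexx _)) _.
rewrite cabsM cabs_real mulrDl addrC; apply: lerD.
  by rewrite mulrC; apply: ler_wpM2r.
apply: le_trans (lerD H4 (BP _)) _.
exact: (curve_increment_error e0 B0 V0 (normr_ge0 h) H1 H2).
Qed.

Lemma curve_length (g g1 : R -> Cn) (a b : R) :
  a <= b -> 0 <= a -> b <= 1 ->
  (forall t, a <= t <= b -> is_velocity g t (g1 t) /\ enorm (g1 t) = 1) ->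
  enorm (g a - g b) <= b - a.
Proof.
move=> ab a0 b1 gv; rewrite -[leRHS]mul1r.
apply: (@mean_value_le R (fun s t => enorm (g s - g t))) => //.
- by move=> s t; exact: enormBC.
- by move=> s t r; exact: enorm_dist_tri.
move=> t tab e e0; have [vt v1] := gv t tab.
have [d d0 P] := velocity_eps vt e0; exists d; first exact: d0.
move=> s sab sd; have /andP[as_ sb] := sab.
have s01 : s \in `[0, 1] by rewrite in_itv /= (le_trans a0 as_) (le_trans sb b1).
have H := P s s01 sd.
rewrite -(subrK ((s - t)%:C *: g1 t) (g s - g t)).
apply: le_trans (enormD _ _) _; rewrite enormZr v1 mulr1 mulrDl mul1r addrC.
exact: (lerD (lexx _) H).
Qed.

End CurveEstimates.

(** * Derivatives in complex tangential directions *)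

Lemma le_powR_r (R : realType) (r x y : R) : 0 <= r -> 0 <= x -> x <= y ->
  x `^ r <= y `^ r.
Proof.
move=> r0 x0 xy; apply: ge0_ler_powR => //; rewrite nnegrE //.
exact: le_trans x0 xy.
Qed.

Lemma ge_powRN (R : realType) (r x y : R) : 0 <= r -> 0 < x -> x <= y ->
  y `^ (- r) <= x `^ (- r).
Proof.
move=> r0 x0 xy; rewrite !powRN lef_pV2 ?posrE ?powR_gt0 //.
  by apply: le_powR_r => //; exact: ltW.
exact: lt_le_trans x0 xy.
Qed.

(** S x y reads: y is the size of some derivative at depth x. At each doubling of
    the depth at most B1 x^(- b) is lost, and these losses form a geometric
    series of ratio 2^(- b) dominated by its first term. *)
Lemma dyadic_growth (R : realType) (b B0 B1 d0 : R) (S : R -> R -> Prop) :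
  0 < b -> 0 < d0 -> 0 <= B0 -> 0 <= B1 ->
  (forall x y, d0 / 2 < x -> x <= d0 -> S x y -> y <= B0) ->
  (forall x y, 0 < x -> x <= d0 / 2 -> S x y ->
     exists2 y', S (2 * x) y' & y <= y' + B1 * x `^ (- b)) ->
  forall x y, 0 < x -> x <= d0 -> S x y ->
    y <= (B0 * d0 `^ b + B1 / (1 - 2 `^ (- b))) * x `^ (- b).
Proof.
move=> b0 d00 B00 B10 top step.
set q := 2 `^ (- b); have q1 : q < 1.
  have p1 : 1 `^ b = 1 :> R by rewrite powR1.
  rewrite /q powRN invf_lt1 ?powR_gt0 // -[ltLHS]p1.
  by apply: gt0_ltr_powR; rewrite ?nnegrE // ltr1n.
have q10 : 0 < 1 - q by rewrite subr_gt0.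
set A := B0 * _ + _.
have A0 : 0 <= A.
  by rewrite addr_ge0 ?mulr_ge0 ?powR_ge0 // invr_ge0 ltW.
have AB : B1 <= A * (1 - q).
  rewrite /A mulrDl divfK ?gt_eqF // lerDr.
  by rewrite !mulr_ge0 ?powR_ge0 // ltW.
have topA x y : d0 / 2 < x -> x <= d0 -> S x y -> y <= A * x `^ (- b).
  move=> x1 x2 Sxy; apply: le_trans (top x y x1 x2 Sxy) _.
  have x0 : 0 < x by apply: le_lt_trans x1; rewrite divr_ge0 // ltW.
  apply: (@le_trans _ _ (A * d0 `^ (- b))); last first.
    by rewrite ler_wpM2l // ge_powRN // ltW.
  rewrite powRN ler_pdivlMr ?powR_gt0 // /A lerDl divr_ge0 //; exact: ltW.
have main j x y : d0 / 2 ^+ j.+1 < x -> x <= d0 -> S x y -> y <= A * x `^ (- b).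
  elim: j x y => [|j IH] x y x1 xd Sxy; first exact: topA Sxy.
  have [xs|xb] := leP x (d0 / 2); last exact: topA Sxy.
  have x0 : 0 < x by apply: le_lt_trans x1; rewrite divr_ge0 ?exprn_ge0 // ltW.
  have [y' Sy' yy'] := step x y x0 xs Sxy.
  have x2 : d0 / 2 ^+ j.+1 < 2 * x.
    move: x1; rewrite (exprS 2 j.+1) invfM mulrCA => x1.
    by rewrite -ltr_pdivrMl.
  have := IH (2 * x) y' x2 _ Sy'.
  rewrite powRM ?(ltW x0) // -/q => /(_ ltac:(lra)) H.
  apply: le_trans yy' _; apply: le_trans (lerD H (lexx _)) _.
  have X0 := powR_ge0 x (- b); set X := x `^ (- b) in X0 *.
  have : B1 * X <= A * (1 - q) * X by rewrite ler_wpM2r.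
  lra.
move=> x y x0 xd Sxy.
have [j jx] := half_pow_small d0 x0.
apply: (main j x y _ xd Sxy); apply: le_lt_trans jx.
rewrite ler_pM2l // lef_pV2 ?posrE ?exprn_gt0 // exprS.
by rewrite ler_peMl ?exprn_ge0 // ler1n.
Qed.

Section Depth.
Variables (R : realType) (n : nat) (Omega U : set 'rV[R[i]]_n).
Local Notation Cn := 'rV[R[i]]_n.
Variables (k : nat) (delta0 alpha : R) (f : Cn -> R[i]).
Hypotheses (oOmega : open Omega) (C1 : C1_boundary Omega) (k0 : (0 < k)%N).
Hypothesis Udisc : uniform_disc_property Omega U k delta0.

(** The complex tangent condition at p in terms of the normal, which makes it
    stable under complex linear combinations. *)
Definition tangent_at (q p L : Cn) :=
  rdot L (unit_normal q p) = 0 /\ rdot ('i%C *: L) (unit_normal q p) = 0.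

Lemma tangent_atD q p u v : tangent_at q p u -> tangent_at q p v ->
  tangent_at q p (u + v).
Proof.
by move=> [u1 u2] [v1 v2]; split; rewrite ?scalerDr rdotDl ?u1 ?u2 ?v1 ?v2 addr0.
Qed.

Lemma tangent_atZr q p (x : R) u : tangent_at q p u ->
  tangent_at q p (x%:C *: u).
Proof.
move=> [u1 u2]; split; first by rewrite rdotZl u1 mulr0.
by rewrite scalerA mulrC -scalerA rdotZl u2 mulr0.
Qed.

Lemma tangent_ati q p u : tangent_at q p u -> tangent_at q p ('i%C *: u).
Proof.
move=> [u1 u2]; split; first exact: u2.
by rewrite rdot_il rdot_ii u1 oppr0.
Qed.

Lemma tangent_atZ q p (c : R[i]) u : tangent_at q p u ->
  tangent_at q p (c *: u).
Proof.
move=> tu; rewrite scale_complex; apply: tangent_atD; apply: tangent_atZr => //.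
exact: tangent_ati.
Qed.

(** The disc property for one tangential direction yields it for all of them at
    once: a displacement e is split into its component along N, absorbed by w1,
    and a complex tangential vector, which is added to w L before rescaling to a
    unit tangential direction. The tangential part of e has size at most
    3 kappa x, and x is at most a constant times x^(1/k). *)
Lemma polydisc_region : exists kappa rho : R, [/\ 0 < kappa, 0 < rho &
  forall q p L : Cn, nearest Omega q p -> U p -> tangent_at q p L -> enorm L = 1 ->
  forall x e w, 0 < x -> x <= delta0 -> enorm e <= kappa * x ->
    cabs w <= rho * x `^ (k%:R^-1) ->
    Omega (p - x%:C *: unit_normal q p + e + w *: L)].
Proof.
have [d0 [c1 [c2 [c10 c20 disc]]]] := Udisc.
have s0 : 0 <= k%:R^-1 :> R by rewrite invr_ge0.
have s1 : k%:R^-1 <= 1 :> R by rewrite invf_le1 ?ltr0n // ler1n.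
pose E := delta0 `^ (1 - k%:R^-1).
have E0 : 0 < E by rewrite powR_gt0.
have xE x : 0 < x -> x <= delta0 -> x <= E * x `^ (k%:R^-1).
  move=> x0 xd.
  have {1}-> : x = x `^ (1 - k%:R^-1) * x `^ (k%:R^-1).
    by rewrite -powRD ?subrK ?powRr1 ?(ltW x0) // gt_eqF ?implybT.
  rewrite ler_wpM2r ?powR_ge0 //.
  by apply: le_powR_r => //; [rewrite subr_ge0|exact: ltW].
pose kappa := Num.min (c1 / 2) (c2 / 6 / E).
have kap0 : 0 < kappa by rewrite lt_min !divr_gt0.
exists kappa, (c2 / 2); split; [exact: kap0|by rewrite divr_gt0|].
move=> q p L qp Up tL L1 x e w x0 xd ex wx.
have [a [v [eE v1 v2 ae ve]]] := hermitian_decomposition e (enorm_unit_normal oOmega qp).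
have kx1 : kappa * x <= c1 / 2 * x by rewrite ler_pM2r // ge_min lexx.
have kx2 : kappa * x <= c2 / 6 * x `^ (k%:R^-1).
  apply: le_trans (ler_wpM2l (ltW kap0) (xE x x0 xd)) _.
  rewrite mulrA ler_wpM2r ?powR_ge0 // -ler_pdivlMr //.
  by rewrite ge_min lexx orbT.
have na : cabs (- a) <= c1 * x.
  rewrite cabsN; apply: le_trans ae _.
  by move: ex kx1; move: (enorm e) => r ex kx1; clear -ex kx1; lra.
have nv : enorm v <= c2 / 2 * x `^ (k%:R^-1).
  apply: le_trans ve _.
  by move: ex kx2; move: (enorm e) (x `^ _) => r y ex kx2; clear -ex kx2; lra.
pose u := v + w *: L.
have nu : enorm u <= c2 * x `^ (k%:R^-1).
  apply: le_trans (enormD _ _) _; rewrite enormZ L1 mulr1.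
  apply: le_trans (lerD nv wx) _; rewrite -mulrDl -splitr; exact: lexx.
have tu : tangent_at q p u by apply: tangent_atD; [split|exact: tangent_atZ].
have oN := nearest_outward_normal oOmega C1 qp.
have ptE (z : Cn) : u = z ->
  p - x%:C *: unit_normal q p + e + w *: L =
  p - x%:C *: unit_normal q p - (- a) *: unit_normal q p + z.
  by move=> <-; rewrite /u {1}eE scaleNr opprK !addrA.
(* If the total tangential displacement vanishes, L itself serves as
   direction, with w2 = 0. *)
have [u0|u0] := eqVneq (enorm u) 0.
  rewrite (ptE (0 *: L)); last by rewrite scale0r (enorm_eq0 u0).
  apply: (disc p (unit_normal q p) L Up oN _ L1 x x0 xd (- a) 0 na).
    exact: (complex_tangentP oOmega _ C1 qp).2.
  by rewrite cabs0 mulr_ge0 ?powR_ge0 // ltW.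
have up : 0 < enorm u by rewrite lt_neqAle eq_sym u0 enorm_ge0.
rewrite (ptE ((enorm u)%:C *: ((enorm u)^-1%:C *: u))); last first.
  by rewrite scalerA -rmorphM divff // scale1r.
apply: (disc p (unit_normal q p) _ Up oN _ _ x x0 xd (- a) _ na).
- apply: (complex_tangentP oOmega _ C1 qp).2; exact: tangent_atZr.
- by rewrite enormZr gtr0_norm ?invr_gt0 // mulVf.
- by rewrite cabs_real gtr0_norm.
Qed.
End Depth.

Lemma cabs_le_add (R : rcfType) (a b : R[i]) (M : R) :
  cabs (a - b) <= M -> cabs a <= cabs b + M.
Proof.
move=> H; rewrite -[leLHS]/(cabs a) -{1}(subrK b a) addrC.
by apply: le_trans (cabsD _ _) _; rewrite lerD2l.
Qed.

Lemma depth_difference (V : zmodType) (p a b e : V) :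
  (p - a + e) - (p - b + e) = b - a.
Proof. by rewrite opprD addrACA subrr addr0 opprB addrC addrA subrK. Qed.

Section Derivative.
Variables (R : realType) (n : nat) (Omega U : set 'rV[R[i]]_n).
Local Notation Cn := 'rV[R[i]]_n.
Variables (k : nat) (delta0 alpha K : R) (f : Cn -> R[i]).
Hypotheses (oOmega : open Omega) (C1 : C1_boundary Omega) (k0 : (0 < k)%N).
Hypothesis Udisc : uniform_disc_property Omega U k delta0.
Hypotheses (alpha0 : 0 < alpha) (alphak : alpha < k%:R^-1).
Hypothesis holo : holomorphic_on Omega f.
Hypothesis K0 : 0 < K.
Hypothesis holder : forall z w, Omega z -> Omega w ->
  cabs (f z - f w) <= K * enorm (z - w) `^ alpha.

Lemma slice_cderiv (z L : Cn) (c : R[i]) : Omega (z + c *: L) ->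
  cderiv (fun s => f (z + s *: L)) c ('d f (z + c *: L) L).
Proof. by move=> Oz; apply: fderiv_line; exact: differentiable_fderiv (holo Oz). Qed.

Lemma slice_oscillation (z L : Cn) (c : R[i]) (r : R) : enorm L = 1 ->
  Omega z -> Omega (z + c *: L) -> cabs c <= r ->
  cabs (f (z + c *: L) - f z) <= K * r `^ alpha.
Proof.
move=> L1 Oz Oc cr; apply: le_trans (holder Oc Oz) _.
rewrite addrC addKr enormZ L1 mulr1; apply: (ler_wpM2l (ltW K0)).
by apply: le_powR_r cr; [exact: ltW|exact: cabs_ge0].
Qed.

Lemma derivative_disc_bound (z L : Cn) (r : R) : 0 < r -> enorm L = 1 ->
  (forall w, cabs w <= r -> Omega (z + w *: L)) ->
  cabs ('d f z L) <= K * r `^ alpha / r.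
Proof.
move=> r0 L1 disc.
have c0r : cabs (0 : R[i]) <= r by rewrite cabs0 ltW.
have Oz := disc 0 c0r; have := slice_cderiv Oz.
rewrite scale0r addr0 in Oz *; move=> dz.
apply: (cauchy_estimate r0 dz).
  by move=> w wr; exists ('d f (z + w *: L) L); exact: slice_cderiv (disc w wr).
move=> w wr; rewrite scale0r addr0.
exact: (slice_oscillation L1 Oz (disc w wr) wr).
Qed.

(** Cauchy's estimate for the difference of f on two parallel discs, which by the
    Hoelder condition is bounded in terms of the distance of the discs rather
    than of their radius. *)
Lemma derivative_difference_bound (y z L : Cn) (r x : R) : 0 < r ->
  enorm (y - z) <= x ->
  (forall w, cabs w <= r -> Omega (y + w *: L)) ->
  (forall w, cabs w <= r -> Omega (z + w *: L)) ->
  cabs ('d f y L) <= cabs ('d f z L) + 2 * K * x `^ alpha / r.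
Proof.
move=> r0 yzx Oy Oz.
pose F w := f (y + w *: L) - f (z + w *: L).
have dF w : cabs w <= r ->
    cderiv F w ('d f (y + w *: L) L - 'd f (z + w *: L) L).
  move=> wr.
  apply: (@cderiv_sub R (fun w => f (y + w *: L)) (fun w => f (z + w *: L))).
    exact: slice_cderiv (Oy w wr).
  exact: slice_cderiv (Oz w wr).
have c00 : cabs (0 : R[i]) <= r by rewrite cabs0 ltW.
have FM w : cabs w <= r -> cabs (F w) <= K * x `^ alpha.
  move=> wr; apply: le_trans (holder (Oy w wr) (Oz w wr)) _.
  rewrite opprD addrACA subrr addr0; apply: (ler_wpM2l (ltW K0)).
  by apply: le_powR_r yzx; [exact: ltW|exact: enorm_ge0].
have H : cabs ('d f y L - 'd f z L) <= 2 * K * x `^ alpha / r.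
  have := dF 0 c00; rewrite !scale0r !addr0 => dF0.
  apply: (cauchy_estimate r0 dF0).
    by move=> w /dF dFw; eexists; exact: dFw.
  move=> w wr; apply: le_trans (cabsB _ _) _.
  apply: le_trans (lerD (FM w wr) (FM 0 c00)) _.
  by rewrite -[in leRHS]mulrA mulr_natl mulr2n.
exact: cabs_le_add H.
Qed.

(** [dyadic_growth] applied to the L-derivatives at the points p - x N + e: down to
    depth delta0 / 2 a disc of fixed radius r0 gives a bound B0, and discs of
    radius rho x^(1/k) at depths x and 2 x give the loss B1 x^(alpha - 1/k). The
    displacement e does not change with the depth. *)
Lemma tangential_derivative_bound : exists kappa A : R, [/\ 0 < kappa, 0 < A &
  forall q p L : Cn, nearest Omega q p -> U p -> tangent_at q p L -> enorm L = 1 ->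
  forall x e, 0 < x -> x <= delta0 -> enorm e <= kappa * x ->
    Omega (p - x%:C *: unit_normal q p + e) /\
    cabs ('d f (p - x%:C *: unit_normal q p + e) L) <=
      A * x `^ (- (k%:R^-1 - alpha))].
Proof.
have d00 : 0 < delta0 by have [] := Udisc.
have [kappa [rho [kap0 rho0 region]]] := polydisc_region oOmega C1 k0 Udisc.
pose s : R := k%:R^-1; pose b := s - alpha.
have b0 : 0 < b by rewrite subr_gt0.
pose r0 := rho * (delta0 / 2) `^ s.
have r00 : 0 < r0 by rewrite mulr_gt0 // powR_gt0 // divr_gt0.
pose B0 := K * r0 `^ alpha / r0; pose B1 := 2 * K / rho.
have B00 : 0 < B0 by rewrite divr_gt0 // mulr_gt0 // powR_gt0.
have B10 : 0 < B1 by rewrite divr_gt0 // mulr_gt0.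
pose S x y := exists q p L e, [/\ nearest Omega q p /\ U p, tangent_at q p L,
  enorm L = 1, enorm e <= kappa * x &
  y = cabs ('d f (p - x%:C *: unit_normal q p + e) L)].
have s0 : 0 <= s by rewrite invr_ge0.
have top x y : delta0 / 2 < x -> x <= delta0 -> S x y -> y <= B0.
  move=> x1 xd [q [p [L [e [[qp Up] tL L1 ee ->]]]]].
  have x0 : 0 < x by apply: lt_trans x1; rewrite divr_gt0.
  have reg := region q p L qp Up tL L1 x e _ x0 xd ee.
  have r0x : r0 <= rho * x `^ s.
    by rewrite /r0 ler_pM2l // le_powR_r ?(ltW x1) // divr_ge0 // ltW.
  apply: (derivative_disc_bound r00 L1) => w wr.
  by apply: reg; exact: le_trans wr r0x.
have step x y : 0 < x -> x <= delta0 / 2 -> S x y ->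
    exists2 y', S (2 * x) y' & y <= y' + B1 * x `^ (- b).
  move=> x0 xd [q [p [L [e [[qp Up] tL L1 ee ->]]]]].
  have [x2 x2E] : exists x2, x2 = 2 * x by exists (2 * x).
  have x20 : 0 < x2 by rewrite x2E mulr_gt0.
  have x2d : x2 <= delta0 by rewrite x2E mulrC -ler_pdivlMr.
  have xx2 : x <= x2 by rewrite x2E ler_peMl ?(ltW x0) // ler1n.
  have x2x : x2 - x = x by rewrite x2E mulr_natl mulr2n addrK.
  rewrite -x2E {x2E}.
  have e2 : enorm e <= kappa * x2.
    by apply: le_trans ee _; rewrite ler_pM2l.
  exists (cabs ('d f (p - x2%:C *: unit_normal q p + e) L)).
    by exists q, p, L, e; split.
  have reg1 := region q p L qp Up tL L1 x e _ x0 (le_trans xx2 x2d) ee.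
  have reg2 := region q p L qp Up tL L1 x2 e _ x20 x2d e2.
  have r_gt0 : 0 < rho * x `^ s by rewrite mulr_gt0 // powR_gt0.
  have -> : B1 * x `^ (- b) = 2 * K * x `^ alpha / (rho * x `^ s).
    rewrite /B1 /b opprB powRB; last by rewrite (gt_eqF x0) implybT.
    by rewrite invfM; ring.
  apply: (derivative_difference_bound r_gt0) => [|w wr|w wr].
  - rewrite depth_difference -scalerBl -rmorphB x2x enormZr gtr0_norm //.
    by rewrite (enorm_unit_normal oOmega qp) mulr1.
  - exact: reg1.
  - apply: reg2; apply: le_trans wr _; rewrite ler_pM2l //.
    by apply: le_powR_r; rewrite ?(ltW x0).
pose A := B0 * delta0 `^ b + B1 / (1 - 2 `^ (- b)).
have q1 : 2 `^ (- b) < 1 :> R.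
  have p1 : 1 `^ b = 1 :> R by rewrite powR1.
  rewrite powRN invf_lt1 ?powR_gt0 // -[ltLHS]p1.
  by apply: gt0_ltr_powR; rewrite ?nnegrE // ltr1n.
exists kappa, A; split; [exact: kap0| |].
  have q2 : 0 < 1 - 2 `^ (- b) :> R by rewrite subr_gt0.
  by apply: addr_gt0; [exact: mulr_gt0 (powR_gt0 _ d00)|exact: divr_gt0].
move=> q p L qp Up tL L1 x e x0 xd ee; split.
  rewrite -[_ + e]addr0 -(scale0r L).
  apply: (region q p L qp Up tL L1 x e 0 x0 xd ee).
  by rewrite cabs0 mulr_ge0 ?powR_ge0 // ltW.
apply: (dyadic_growth b0 d00 (ltW B00) (ltW B10) top step x0 xd).
by exists q, p, L, e; split.
Qed.

End Derivative.

(** * Tangential curves near the boundary *)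

(** At depth x = h^k a derivative of size x^(alpha - 1/k) accumulates
    h^(k alpha) over a length h, as much as the Hoelder bound x^alpha. *)
Lemma powR_scale (R : realType) (k : nat) (alpha h : R) : (0 < k)%N -> 0 < h ->
  (h ^+ k) `^ alpha = h `^ (k%:R * alpha) /\
  (h ^+ k) `^ (- (k%:R^-1 - alpha)) * h = h `^ (k%:R * alpha).
Proof.
move=> k0 h0; rewrite -!(powR_mulrn k (ltW h0)) -!powRrM; split=> //.
rewrite -[X in _ * X](powRr1 (ltW h0)) -powRD; last by rewrite (gt_eqF h0) implybT.
by congr (_ `^ _); field; rewrite pnatr_eq0 -lt0n.
Qed.

Lemma pushed_point (F : pzRingType) (V : lmodType F) (p N N0 : V) (d h : F) :
  p - d *: N - h *: N0 = p - (d + h) *: N + h *: (N - N0).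
Proof. by rewrite scalerDl scalerBr opprD !addrA subrK. Qed.

Section TangentialCurve.
Variables (R : realType) (n : nat) (Omega U : set 'rV[R[i]]_n).
Local Notation Cn := 'rV[R[i]]_n.
Variables (k : nat) (delta0 alpha K kappa A eta : R) (f : Cn -> R[i]).
Hypotheses (oOmega : open Omega) (k0 : (0 < k)%N).
Hypothesis alphak : alpha < k%:R^-1.
Hypothesis holo : holomorphic_on Omega f.
Hypotheses (K0 : 0 < K) (A0 : 0 < A) (kappa0 : 0 < kappa).
Hypothesis holder : forall z w, Omega z -> Omega w ->
  cabs (f z - f w) <= K * enorm (z - w) `^ alpha.
Hypothesis tangential : forall q p L : Cn, nearest Omega q p -> U p ->
  tangent_at q p L -> enorm L = 1 ->
  forall x e, 0 < x -> x <= delta0 -> enorm e <= kappa * x ->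
    Omega (p - x%:C *: unit_normal q p + e) /\
    cabs ('d f (p - x%:C *: unit_normal q p + e) L) <=
      A * x `^ (- (k%:R^-1 - alpha)).
Hypothesis normal_close : forall q q' p p', U p -> U p' ->
  nearest Omega q p -> nearest Omega q' p' -> enorm (p - p') < eta ->
  enorm (unit_normal q p - unit_normal q' p') <= kappa.

Variables (g g1 P : R -> Cn).
Hypothesis curve : forall t, 0 <= t <= 1 -> [/\ is_velocity g t (g1 t),
  nearest Omega (g t) (P t) /\ U (P t), tangent_at (g t) (P t) (g1 t),
  enorm (g1 t) = 1 & enorm (g t - P t) <= delta0 / 5].

Let b0 : 0 <= k%:R^-1 - alpha. Proof. by rewrite subr_ge0 ltW. Qed.

(** The bound A x^(alpha - 1/k) is largest at the smallest depth H. *)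
Lemma shifted_curve_variation (u : Cn) (a b H : R) (x : R -> R) (e : R -> Cn) :
  a <= b -> 0 <= a -> b <= 1 -> 0 < H ->
  (forall t, a <= t <= b -> [/\ H <= x t, x t <= delta0, enorm (e t) <= kappa * x t &
     g t - u = P t - (x t)%:C *: unit_normal (g t) (P t) + e t]) ->
  cabs (f (g a - u) - f (g b - u)) <= A * H `^ (- (k%:R^-1 - alpha)) * (b - a).
Proof.
move=> ab a0 b1 H0 xe.
have I t : a <= t <= b -> 0 <= t <= 1.
  by move=> /andP[at_ tb]; rewrite (le_trans a0 at_) (le_trans tb b1).
apply: (@curve_variation R n f g g1) => // t tab.
  by have [] := curve (I t tab).
have [v [near Up] tan unit _] := curve (I t tab).
have [Hx xd ex ->] := xe t tab.
have x0 := lt_le_trans H0 Hx.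
have [Oz dz] := tangential near Up tan unit x0 xd ex.
split; first exact: holo.
apply: le_trans dz _; apply: (ler_wpM2l (ltW A0)); exact: ge_powRN.
Qed.

Lemma curve_dist s t : 0 <= s <= 1 -> 0 <= t <= 1 ->
  enorm (g s - g t) <= `|s - t|.
Proof.
wlog st : s t / s <= t => [W s01 t01|/andP[s0 s1] /andP[t0 t1]].
  have [st|/ltW ts] := leP s t; first exact: W.
  by rewrite enormBC distrC; exact: W.
rewrite distrC ger0_norm ?subr_ge0 //.
apply: (@curve_length R n g g1) => // r /andP[sr rt].
have r01 : 0 <= r <= 1 by rewrite (le_trans s0 sr) (le_trans rt t1).
by have [] := curve r01.
Qed.

(** Either the curve is at depth at least H = h^k throughout, or it is pushed
    inwards by H N0, where N0 is the normal at a parameter t0 with depth less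
    than H. In the second case the curve is within h + H of the boundary, so the
    projections stay within 2 (h + H) <= 4 h of each other and the normals
    remain close to N0. *)
Lemma short_curve_estimate (a b : R) : a < b -> 0 <= a -> b <= 1 ->
  b - a <= delta0 / 5 -> 4 * (b - a) < eta ->
  cabs (f (g a) - f (g b)) <= (A + 2 * K) * (b - a) `^ (k%:R * alpha).
Proof.
move=> ab a0 b1 hd heta.
pose h := b - a; have h0 : 0 < h by rewrite subr_gt0.
have h1 : h <= 1 by rewrite /h; lra.
rewrite -/h in hd heta *.
pose H := h ^+ k; have H0 : 0 < H by rewrite exprn_gt0.
have Hh : H <= h by rewrite /H -[leRHS]expr1 ler_wiXn2l // ltW.
have [p1 p2] := powR_scale alpha k0 h0; rewrite -/H in p1 p2.
have X0 := powR_ge0 h (k%:R * alpha).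
have I t : a <= t <= b -> 0 <= t <= 1.
  by move=> /andP[at_ tb]; rewrite (le_trans a0 at_) (le_trans tb b1).
have aab : a <= a <= b by rewrite lexx ltW.
have bab : a <= b <= b by rewrite lexx ltW.
have main M : M <= A * H `^ (- (k%:R^-1 - alpha)) * (b - a) ->
    M <= A * h `^ (k%:R * alpha) by rewrite -mulrA p2.
have two_h : h + H + (h + H) <= 4 * h by lra.
have total X : K * X + (A * X + K * X) <= (A + 2 * K) * X by lra.
have depth_le r : r <= delta0 / 5 -> r + H <= delta0 by lra.
have [deep|] := pselect (forall t, a <= t <= b -> H <= enorm (g t - P t)).
  have := @shifted_curve_variation 0 a b H (fun t => enorm (g t - P t)) (fun=> 0)
    (ltW ab) a0 b1 H0.
  rewrite !subr0 => /(_ _)/main.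
  move=> V; apply: le_trans (V _) _; last first.
    by rewrite ler_wpM2r // lerDl mulr_ge0 // ltW.
  move=> t tab; have [_ [near _] _ _ dt] := curve (I t tab).
  split; [exact: deep|by apply: le_trans dt _; lra| |].
    by rewrite enorm0 mulr_ge0 ?enorm_ge0 // ltW.
  by rewrite subr0 addr0; exact: unit_normalE near.
move=> /existsNP[t0 /not_implyP[t0ab /negP]]; rewrite -ltNge => shallow.
have [_ [near0 U0] _ _ _] := curve (I t0 t0ab).
set N0 := unit_normal (g t0) (P t0); pose u := H%:C *: N0.
have uH : enorm u = H.
  by rewrite enormZr gtr0_norm // (enorm_unit_normal oOmega near0) mulr1.
have conf t : a <= t <= b -> [/\ H <= enorm (g t - P t) + H,
    enorm (g t - P t) + H <= delta0,
    enorm (H%:C *: (unit_normal (g t) (P t) - N0)) <= kappa * (enorm (g t - P t) + H) &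
    g t - u = P t - (enorm (g t - P t) + H)%:C *: unit_normal (g t) (P t)
      + H%:C *: (unit_normal (g t) (P t) - N0)].
  move=> tab; have [_ [near Ut] _ _ dt] := curve (I t tab).
  have gg : enorm (g t - g t0) <= h.
    apply: le_trans (curve_dist (I t tab) (I t0 t0ab)) _.
    by rewrite ler_distl /h; move: tab t0ab; lra.
  have dd : enorm (g t - P t) <= h + H.
    have [_ _ min] := near; have [_ b0' _] := near0.
    apply: le_trans (min _ b0') _.
    apply: le_trans (enorm_dist_tri _ (g t0) _) _.
    exact: lerD gg (ltW shallow).
  have pp : enorm (P t - P t0) < eta.
    apply: le_lt_trans heta.
    apply: le_trans (enorm_dist_tri _ (g t) _) _.
    apply: le_trans (lerD (lexx _) (enorm_dist_tri _ (g t0) _)) _.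
    rewrite enormBC.
    apply: le_trans (lerD dd (lerD gg (ltW shallow))) _.
    exact: two_h.
  have nc := normal_close Ut U0 near near0 pp.
  split.
  - by rewrite lerDr enorm_ge0.
  - exact: depth_le dt.
  - rewrite enormZr gtr0_norm // mulrC.
    apply: (le_trans (ler_wpM2r (ltW H0) nc)).
    by rewrite ler_pM2l // lerDr enorm_ge0.
  - rewrite (rmorphD _ (enorm (g t - P t)) H) -pushed_point.
    exact: (congr1 (fun z => z - u) (unit_normalE oOmega near)).
have V := main _ (shifted_curve_variation (ltW ab) a0 b1 H0 conf).
have inO t : a <= t <= b -> Omega (g t - u).
  move=> tab; have [v [near Ut] tan unit _] := curve (I t tab).
  have [Hx xd ex ->] := conf t tab.
  by have [] := tangential near Ut tan unit (lt_le_trans H0 Hx) xd ex.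
have endpoint t : a <= t <= b ->
    cabs (f (g t) - f (g t - u)) <= K * h `^ (k%:R * alpha).
  move=> tab; have [_ [[Og _ _] _] _ _ _] := curve (I t tab).
  apply: le_trans (holder Og (inO t tab)) _.
  by rewrite opprB addrC subrK uH p1.
have ea := endpoint a aab; have eb := endpoint b bab.
rewrite cabsBC in eb.
rewrite -(subrKA (f (g a - u))) -(subrKA (f (g b - u)) (f (g a - u))).
apply: le_trans (cabsD _ _) _.
apply: le_trans (lerD ea (cabsD _ _)) _.
apply: le_trans (lerD (lexx _) (lerD V eb)) _.
exact: total.
Qed.

End TangentialCurve.

Theorem theorem3p8 (R : realType) (n : nat) (Omega : set 'rV[R[i]]_n)
    (U : set 'rV[R[i]]_n) (k : nat) (delta0 alpha : R)
    (f : 'rV[R[i]]_n -> R[i])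
    (V : set 'rV[R[i]]_n) (pi_ : 'rV[R[i]]_n -> 'rV[R[i]]_n) :
  (2 <= n)%N ->
  domain Omega ->
  C1_boundary Omega ->
  (exists2 O, open O & U = bd Omega `&` O) ->
  compact (closure U) ->
  (0 < k)%N ->
  uniform_disc_property Omega U k delta0 ->
  0 < alpha -> alpha < k%:R^-1 ->
  holomorphic_on Omega f ->
  holder_on Omega alpha f ->
  normal_projection Omega V pi_ ->
  exists2 C : R, 0 < C &
    forall g : R -> 'rV[R[i]]_n,
      normalized_complex_tangential_curve Omega V pi_ g ->
      (forall t : R, t \in `[0, 1] ->
         dist_to (bd Omega) (g t) <= delta0 / 5 /\ U (pi_ (g t))) ->
      forall s t : R, s \in `[0, 1] -> t \in `[0, 1] ->
        cabs (f (g s) - f (g t)) <= C * `|s - t| `^ (k%:R * alpha).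
Proof.
move=> _ [_ oOmega _] C1 [W _ UW] cU k0 Udisc alpha0 alphak holo [K1 holder0] [_ _ projP].
have d00 : 0 < delta0 by have [] := Udisc.
have [K K_gt0 holder] : exists2 K : R, 0 < K & forall z w, Omega z -> Omega w ->
    cabs (f z - f w) <= K * enorm (z - w) `^ alpha.
  exists (`|K1| + 1); first by rewrite ltr_wpDl.
  move=> z w Oz Ow; apply: le_trans (holder0 z w Oz Ow) _.
  apply: (ler_wpM2r (powR_ge0 _ _)); apply: le_trans (ler_norm K1) _.
  by rewrite lerDl.
have [kappa [A [kap0 A0 tangential]]] :=
  tangential_derivative_bound oOmega C1 k0 Udisc alpha0 alphak holo K_gt0 holder.
have Ubd : U `<=` bd Omega by rewrite UW => z [].
have [eta eta0 normal_close] := unit_normal_unif_cont oOmega C1 Ubd cU kap0.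
have ka0 : 0 < k%:R * alpha by rewrite mulr_gt0 // ltr0n.
(* Parameter intervals shorter than h0 satisfy the hypotheses of the short curve
   estimate; C2 makes the Hoelder bound sufficient for the longer ones. *)
pose h0 := Num.min (delta0 / 5) (eta / 5).
have h00 : 0 < h0 by rewrite lt_min !divr_gt0.
pose C2 := K / h0 `^ (k%:R * alpha).
have C20 : 0 < C2 by rewrite divr_gt0 // powR_gt0.
exists (A + 2 * K + C2); first by rewrite addr_gt0 // addr_gt0 // mulr_gt0.
move=> g [g1 [g2 [[vel _] tan]]] near_bd.
have I t : 0 <= t <= 1 -> t \in `[0, 1] by rewrite in_itv.
have curve t : 0 <= t <= 1 -> [/\ is_velocity g t (g1 t),
    nearest Omega (g t) (pi_ (g t)) /\ U (pi_ (g t)),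
    tangent_at (g t) (pi_ (g t)) (g1 t), enorm (g1 t) = 1 &
    enorm (g t - pi_ (g t)) <= delta0 / 5].
  move=> /I t01; have [vt _] := vel t t01; have [Og Vg tg g11] := tan t t01.
  have [dd Up] := near_bd t t01; have [bp pd] := projP _ Vg.
  have near : nearest Omega (g t) (pi_ (g t)).
    split; [exact: Og|exact: bp|move=> p' bp'].
    rewrite pd; apply: ge_inf; last by exists p'.
    by exists 0 => _ [p _ <-]; exact: enorm_ge0.
  split; [exact: vt|by split| |exact: g11|by rewrite pd].
  exact: (complex_tangentP oOmega _ C1 near).1 tg.
suff key a b : 0 <= a -> a < b -> b <= 1 -> cabs (f (g a) - f (g b)) <=
    (A + 2 * K + C2) * (b - a) `^ (k%:R * alpha).
  move=> s t; rewrite !in_itv /= => /andP[s0 s1] /andP[t0 t1].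
  have [st|ts|->] := ltgtP s t.
  - by rewrite distrC gtr0_norm ?subr_gt0 //; exact: key.
  - by rewrite cabsBC gtr0_norm ?subr_gt0 //; exact: key.
  - by rewrite !subrr cabs0 normr0 powR0 ?mulr0 // gt_eqF.
move=> a0 ab b1; have ba0 : 0 < b - a by rewrite subr_gt0.
have X0 := powR_ge0 (b - a) (k%:R * alpha).
have [small|large] := ltP (b - a) h0.
  move: small; rewrite lt_min => /andP[small1 small2].
  have small3 : 4 * (b - a) < eta by lra.
  apply: le_trans (short_curve_estimate oOmega k0 alphak holo K_gt0 A0 kap0
    holder tangential normal_close curve ab a0 b1 (ltW small1) small3) _.
  by rewrite ler_wpM2r // lerDl ltW.
have a01 : 0 <= a <= 1 by rewrite a0 ltW // (lt_le_trans ab).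
have b01 : 0 <= b <= 1 by rewrite b1 andbT (le_trans a0) // ltW.
have [_ [[Oa _ _] _] _ _ _] := curve a a01.
have [_ [[Ob _ _] _] _ _ _] := curve b b01.
have gab := curve_dist curve a01 b01.
have gab1 : enorm (g a - g b) <= 1.
  by apply: le_trans gab _; rewrite ler_distl; lra.
apply: le_trans (holder _ _ Oa Ob) _.
apply: (@le_trans _ _ (C2 * (b - a) `^ (k%:R * alpha))); last first.
  by rewrite ler_wpM2r // lerDr addr_ge0 ?mulr_ge0 // ltW.
rewrite /C2 mulrAC ler_pdivlMr ?powR_gt0 // -mulrA ler_pM2l //.
have e1 : enorm (g a - g b) `^ alpha <= 1.
  have <- : 1 `^ alpha = 1 :> R by rewrite powR1.
  by apply: le_powR_r gab1; [exact: ltW|exact: enorm_ge0].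
apply: le_trans (ler_wpM2r (powR_ge0 _ _) e1) _.
by rewrite mul1r; apply: le_powR_r large; exact: ltW.
Qed.
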